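(* The matroids $V_1$, $V_2$, and $V_3$ each have characteristic set $\{2\}$. The matroids $P_1$, $P_2$, and $P_3$ each have characteristic set $(\mathcal{P}-\{3\})\cup\{0\}$, where $\mathcal{P}$ is the set of primes. Each of these six matroids is an excluded minor for $\mathcal{AC}_4$ (i.e., is not in $\mathcal{AC}_4$ while every proper minor is). Moreover, $V_2$ and $P_2$ are each isomorphic to their duals.
   Context: The characteristic set of a matroid $M$ is the set of $k$ such that $M$ is representable over some field of characteristic $k$ (with $k$ a prime or $0$). $\mathcal{AC}_4$ is the class of $\mathrm{GF}(4)$-representable matroids representable over some field of every characteristic. Let $\alpha\in\mathrm{GF}(4)$ satisfy $\alpha^2=\alpha+1$. $V_1,V_2,V_3,P_1,P_2,P_3$ are the column matroids over $\mathrm{GF}(4)$ of (rows separated by semicolons): $V_1$: $[1,0,0,1,0,1,1,1,1;\ 0,1,0,1,1,\alpha^2,\alpha^2,\alpha,0;\ 0,0,1,0,1,1,\alpha,1,\alpha]$. $V_2$: $[1,0,0,0,1,1,1,0;\ 0,1,0,0,\alpha^2,\alpha,\alpha,1;\ 0,0,1,0,\alpha,\alpha^2,\alpha,1;\ 0,0,0,1,\alpha^2,\alpha^2,\alpha,\alpha]$. $V_3$: $[1,0,0,0,1,0,1,1,1;\ 0,1,0,0,\alpha,1,\alpha^2,\alpha^2,1;\ 0,0,1,0,\alpha,1,\alpha,1,\alpha^2;\ 0,0,0,1,0,1,1,0,0]$. $P_1$: $[0,1,1,1,1,1,0,0,0;\ 0,1,\alpha,0,0,0,1,1,1;\ 1,0,0,1,\alpha,\alpha^2,1,\alpha,\alpha^2]$.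 $P_2$: $[1,0,0,0,1,0,1,1;\ 0,1,0,0,\alpha,1,1,1;\ 0,0,1,0,1,1,0,1;\ 0,0,0,1,\alpha^2,1,\alpha^2,0]$. $P_3$: $[0,1,1,1,1,1,1,0,0;\ 0,1,\alpha,\alpha^2,0,0,0,1,1;\ 1,0,0,0,1,\alpha,\alpha^2,1,\alpha]$. *)

(* Defs.v *)
From HB Require Import structures.
From mathcomp Require Import all_boot all_order all_algebra.
From mathcomp Require Import zify.

Set Implicit Arguments.
Unset Strict Implicit.
Unset Printing Implicit Defensive.

Import GRing.Theory.
Local Open Scope ring_scope.

(* The ground set is a subset of a fixed finite type, so that a matroid and   *)
(* all its minors live over the same type.                                    *)
Record matroid (T : finType) := Matroid {
  ground : {set T};
  indep : {set {set T}};
  indep_sub : forall I, I \in indep -> I \subset ground;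
  indep0 : set0 \in indep;
  indepS : forall I J : {set T}, I \subset J -> J \in indep -> I \in indep;
  indep_aug : forall I J, I \in indep -> J \in indep -> (#|I| < #|J|)%N ->
    exists2 x, x \in J :\: I & x |: I \in indep
}.

Definition bases (T : finType) (M : matroid T) : {set {set T}} :=
  [set B | maxset (mem (indep M)) B].

Section Matroid.
Variables (T : finType) (M : matroid T).

Lemma indep_extend (I J : {set T}) :
  I \in indep M -> J \in indep M -> (#|I| <= #|J|)%N ->
  exists K, [/\ K \in indep M, I \subset K, K \subset I :|: J & #|K| = #|J|].
Proof.
move: {2}(#|J| - #|I|)%N (erefl (#|J| - #|I|)%N) => n.
elim: n I => [|n IHn] I eqn iI iJ leIJ.
  exists I; split; rewrite ?subxx ?subsetUl //.
  by apply/eqP; rewrite eqn_leq leIJ -subn_eq0 eqn.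
have ltIJ : (#|I| < #|J|)%N by rewrite -subn_gt0 eqn.
have [x /setDP[xJ xI] ixI] := indep_aug iI iJ ltIJ.
have cxI : #|x |: I| = #|I|.+1 by rewrite cardsU1 xI.
have [||K [iK sK KS cK]] := IHn (x |: I) _ ixI iJ.
- by rewrite cxI subnS eqn.
- by rewrite cxI.
exists K; split=> //; first exact: subset_trans (subsetUr _ _) sK.
apply: subset_trans KS _; rewrite subUset subsetUr andbT.
by rewrite subUset subsetUl sub1set inE xJ orbT.
Qed.

Lemma bases_indep B : B \in bases M -> B \in indep M.
Proof. by rewrite inE => /maxsetp. Qed.

Lemma indep_le_basis I B : I \in indep M -> B \in bases M -> (#|I| <= #|B|)%N.
Proof.
move=> iI; rewrite inE => /maxsetP[iB maxB]; rewrite leqNgt; apply/negP => lt.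
have [x /setDP[_ xB] ixB] := indep_aug iB iI lt.
by move: xB; rewrite -(maxB _ ixB (subsetUr _ _)) setU11.
Qed.

Lemma bases_ex : exists B, B \in bases M.
Proof.
have [B mB _] := @maxset_exists _ (mem (indep M)) set0 (indep0 M).
by exists B; rewrite inE.
Qed.

Lemma card_basis I B : B \in bases M -> I \in indep M -> #|I| = #|B| ->
  I \in bases M.
Proof.
move=> bB iI cI; rewrite inE; apply/maxsetP; split=> // J iJ sIJ.
apply/eqP; rewrite eq_sym eqEcard sIJ cI; exact: indep_le_basis.
Qed.

Definition dual_indep : {set {set T}} :=
  [set I : {set T} | (I \subset ground M) &&
                     [exists B in bases M, [disjoint I & B]]].

Fact dual_sub I : I \in dual_indep -> I \subset ground M.
Proof. by rewrite inE => /andP[]. Qed.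

Fact dual0 : set0 \in dual_indep.
Proof.
rewrite inE sub0set; have [B bB] := bases_ex.
by apply/existsP; exists B; rewrite bB -setI_eq0 set0I eqxx.
Qed.

Fact dualS (I J : {set T}) : I \subset J -> J \in dual_indep -> I \in dual_indep.
Proof.
move=> sIJ; rewrite !inE => /andP[sJ /existsP[B /andP[bB dJB]]].
rewrite (subset_trans sIJ sJ); apply/existsP; exists B.
by rewrite bB (disjointWl sIJ dJB).
Qed.

Fact dual_aug (I J : {set T}) : I \in dual_indep -> J \in dual_indep ->
  (#|I| < #|J|)%N -> exists2 x, x \in J :\: I & x |: I \in dual_indep.
Proof.
rewrite !inE => /andP[sI /existsP[B /andP[bB dB]]].
case/andP=> sJ /existsP[D /andP[bD dD]] ltIJ.
have iDI : D :\: I \in indep M := indepS (subsetDl _ _) (bases_indep bD).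
have [K [iK sK KS cK]] :=
  indep_extend iDI (bases_indep bB) (indep_le_basis iDI bB).
have bK := card_basis bB iK cK.
have dIK : [disjoint I & K].
  apply/pred0P=> x /=; apply/negP=> /andP[xI /(subsetP KS)].
  by rewrite !inE xI /= => xB; rewrite (disjointFr dB xI) in xB.
have [sJK|/subsetPn[x xJI xK]] := boolP (J :\: I \subset K); last first.
  have /setDP[xJ xI] := xJI.
  exists x => //; rewrite inE subUset sub1set (subsetP sJ) // sI /=.
  apply/existsP; exists K; rewrite bK /=.
  apply/pred0P=> y /=; rewrite !inE.
  case: eqP => [->|_] /=; first exact/negbTE.
  by apply/negP=> /andP[yI]; rewrite (disjointFr dIK yI).
have le1 : (#|J :\: I :|: D :\: I| <= #|D|)%N.
  apply: leq_trans (indep_le_basis iK bD); apply: subset_leq_card.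
  by rewrite subUset sJK.
have dJD : (J :\: I) :&: (D :\: I) = set0.
  apply/setP=> x; rewrite !inE; case: (boolP (x \in J)) => [xJ|]; last first.
    by rewrite andbF.
  by rewrite (disjointFr dD xJ) !andbF.
have dIJD : (I :&: J) :&: (I :&: D) = set0.
  apply/setP=> x; rewrite !inE; case: (boolP (x \in J)) => [xJ|]; last first.
    by rewrite !andbF.
  by rewrite (disjointFr dD xJ) !andbF.
have le2 : (#|I :&: J :|: I :&: D| <= #|I|)%N.
  by apply: subset_leq_card; rewrite subUset !subsetIl.
move: le1 le2; rewrite !cardsU dJD dIJD cards0 !subn0.
have := cardsID I J; have := cardsID I D; rewrite ![_ :&: I]setIC.
by move: ltIJ; clear; lia.
Qed.

Definition dual : matroid T := Matroid dual_sub dual0 dualS dual_aug.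

Variable D : {set T}.

Definition delete_indep : {set {set T}} :=
  [set I in indep M | I \subset ground M :\: D].

Fact delete_sub I : I \in delete_indep -> I \subset ground M :\: D.
Proof. by rewrite inE => /andP[]. Qed.

Fact delete0 : set0 \in delete_indep.
Proof. by rewrite inE indep0 sub0set. Qed.

Fact deleteS (I J : {set T}) : I \subset J -> J \in delete_indep -> I \in delete_indep.
Proof.
move=> sIJ; rewrite !inE => /andP[iJ sJ].
by rewrite (indepS sIJ iJ) (subset_trans sIJ sJ).
Qed.

Fact delete_aug (I J : {set T}) : I \in delete_indep -> J \in delete_indep ->
  (#|I| < #|J|)%N -> exists2 x, x \in J :\: I & x |: I \in delete_indep.
Proof.
rewrite !inE => /andP[iI sI] /andP[iJ sJ] ltIJ.
have [x xJI ix] := indep_aug iI iJ ltIJ; exists x => //.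
by rewrite inE ix subUset sI sub1set (subsetP sJ) //; case/setDP: xJI.
Qed.

Definition delete : matroid T :=
  Matroid delete_sub delete0 deleteS delete_aug.

End Matroid.

Definition contract (T : finType) (M : matroid T) (C : {set T}) : matroid T :=
  dual (delete (dual M) C).

Definition proper_minor (T : finType) (N M : matroid T) : Prop :=
  exists C D : {set T},
    [/\ C \subset ground M, D \subset ground M, [disjoint C & D],
        C :|: D != set0 & N = delete (contract M C) D].

(* The bijection is between the ground sets as subtypes: with a function      *)
(* T -> U instead, empty matroids would fail to be isomorphic when only U is  *)
(* empty.                                                                     *)
Definition isomorphic (T U : finType) (M : matroid T) (N : matroid U) : Prop :=
  exists2 f : {x : T | x \in ground M} -> {y : U | y \in ground N},
    bijective f &
    forall I : {set {x : T | x \in ground M}},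
      ([set val (f x) | x in I] \in indep N) =
      ([set val x | x in I] \in indep M).

Section ColumnMatroid.
Variables (F : fieldType) (r n : nat) (A : 'M[F]_(r, n)).

Definition column_indep : {set {set 'I_n}} :=
  [set I : {set 'I_n} | free [seq col i A | i <- enum I]].

Fact column_sub I : I \in column_indep -> I \subset [set: 'I_n].
Proof. by rewrite subsetT. Qed.

Fact column0 : set0 \in column_indep.
Proof. by rewrite inE enum_set0 /= nil_free. Qed.

Lemma column_indepU1 x (I : {set 'I_n}) : x \notin I ->
  (x |: I \in column_indep) =
  (col x A \notin <<[seq col i A | i <- enum I]>>%VS) && (I \in column_indep).
Proof.
move=> xI; rewrite !inE -free_cons; apply: perm_free.
rewrite -[_ :: _]/([seq col i A | i <- x :: enum I]).
apply/perm_map/uniq_perm; rewrite /= ?enum_uniq ?mem_enum ?xI // => y.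
by rewrite inE !mem_enum in_setU1.
Qed.

Fact columnS (I J : {set 'I_n}) :
  I \subset J -> J \in column_indep -> I \in column_indep.
Proof.
move=> sIJ; rewrite !inE.
suff /perm_free-> : perm_eq [seq col i A | i <- enum J]
  ([seq col i A | i <- enum I] ++ [seq col i A | i <- enum (J :\: I)]).
  exact: catl_free.
rewrite -map_cat; apply/perm_map/uniq_perm; rewrite ?enum_uniq //.
  rewrite cat_uniq !enum_uniq andbT /=; apply/hasPn=> y.
  by rewrite !mem_enum => /setDP[].
move=> y; rewrite mem_cat !mem_enum inE.
by case: (boolP (y \in I)) => //= /(subsetP sIJ).
Qed.

Fact column_aug (I J : {set 'I_n}) :
  I \in column_indep -> J \in column_indep -> (#|I| < #|J|)%N ->
  exists2 x, x \in J :\: I & x |: I \in column_indep.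
Proof.
move=> iI iJ ltIJ; apply/exists_inP; apply: contraLR ltIJ.
move=> /exists_inPn noaug; rewrite -leqNgt.
have sJI : (<<[seq col i A | i <- enum J]>> <=
            <<[seq col i A | i <- enum I]>>)%VS.
  apply/span_subvP=> _ /mapP[x + ->]; rewrite mem_enum => xJ.
  have [xI|xI] := boolP (x \in I).
    by apply/memv_span/map_f; rewrite mem_enum.
  have := noaug x; rewrite inE xI xJ => /(_ isT).
  by rewrite column_indepU1 // iI andbT negbK.
move: iI iJ (dimvS sJI); rewrite !inE /free => /eqP-> /eqP->.
by rewrite !size_map -!cardE.
Qed.

Definition column_matroid : matroid 'I_n :=
  Matroid column_sub column0 columnS column_aug.

End ColumnMatroid.

Definition representable (F : fieldType) (T : finType) (M : matroid T) : Prop :=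
  exists (r n : nat) (A : 'M[F]_(r, n)), isomorphic M (column_matroid A).

Definition has_char (F : fieldType) (k : nat) : Prop :=
  if k == 0%N then [pchar F] =i pred0 else k \in [pchar F].

Definition char_set (T : finType) (M : matroid T) (k : nat) : Prop :=
  exists2 F : fieldType, has_char F k & representable F M.

Definition matroid_class := forall T : finType, matroid T -> Prop.

Definition excluded_minor (P : matroid_class) (T : finType) (M : matroid T) :
  Prop := ~ P T M /\ forall N : matroid T, proper_minor N M -> P T N.

(* The F-representable matroids that are representable over some field of     *)
(* every characteristic; AC_4 is the case F = GF(4).                          *)
Definition all_char (F : fieldType) : matroid_class := fun T M =>
  representable F M /\ forall k : nat, prime k \/ k = 0%N -> char_set M k.

Definition mx_of_rows (F : fieldType) (r n : nat) (s : seq (seq F)) :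
  'M[F]_(r, n) := \matrix_(i, j) (nth [::] s i)`_j.

Section Matroids.
Variables (F : fieldType) (a : F).

Definition V1 : matroid 'I_9 := column_matroid (mx_of_rows 3 9
  [:: [:: 1; 0; 0; 1; 0; 1;      1;      1; 1];
      [:: 0; 1; 0; 1; 1; a ^+ 2; a ^+ 2; a; 0];
      [:: 0; 0; 1; 0; 1; 1;      a;      1; a]]).

Definition V2 : matroid 'I_8 := column_matroid (mx_of_rows 4 8
  [:: [:: 1; 0; 0; 0; 1;      1;      1; 0];
      [:: 0; 1; 0; 0; a ^+ 2; a;      a; 1];
      [:: 0; 0; 1; 0; a;      a ^+ 2; a; 1];
      [:: 0; 0; 0; 1; a ^+ 2; a ^+ 2; a; a]]).

Definition V3 : matroid 'I_9 := column_matroid (mx_of_rows 4 9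
  [:: [:: 1; 0; 0; 0; 1; 0; 1;      1;      1];
      [:: 0; 1; 0; 0; a; 1; a ^+ 2; a ^+ 2; 1];
      [:: 0; 0; 1; 0; a; 1; a;      1;      a ^+ 2];
      [:: 0; 0; 0; 1; 0; 1; 1;      0;      0]]).

Definition P1 : matroid 'I_9 := column_matroid (mx_of_rows 3 9
  [:: [:: 0; 1; 1; 1; 1; 1;      0; 0; 0];
      [:: 0; 1; a; 0; 0; 0;      1; 1; 1];
      [:: 1; 0; 0; 1; a; a ^+ 2; 1; a; a ^+ 2]]).

Definition P2 : matroid 'I_8 := column_matroid (mx_of_rows 4 8
  [:: [:: 1; 0; 0; 0; 1;      0; 1;      1];
      [:: 0; 1; 0; 0; a;      1; 1;      1];
      [:: 0; 0; 1; 0; 1;      1; 0;      1];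
      [:: 0; 0; 0; 1; a ^+ 2; 1; a ^+ 2; 0]]).

Definition P3 : matroid 'I_9 := column_matroid (mx_of_rows 3 9
  [:: [:: 0; 1; 1; 1;      1; 1; 1;      0; 0];
      [:: 0; 1; a; a ^+ 2; 0; 0; 0;      1; 1];
      [:: 1; 0; 0; 0;      1; a; a ^+ 2; 1; a]]).

End Matroids.

(* Main.v *)
Require Import Defs.
From mathcomp Require Import all_boot all_order all_algebra all_field.
From mathcomp Require Import zify ring.

(** Let A and B be matrices with r rows, over possibly different fields, whose
    nonzero r x r minors sit at the same columns, except at a single set S of
    columns. Then M[A] and M[B] have the same minors as soon as an element of S
    is deleted or an element outside S is contracted. For each of the six
    matroids M[A], finitely many such matrices B, whose exceptional sets cover
    the ground set and have empty intersection, therefore represent all the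
    proper minors.

    For V1, V2 and V3 the matrices B have entries in Z[t] with t^2 = t + 1; all
    their relevant minors are 0 or units, so they work over any field containing
    a root of that polynomial, in every characteristic. P1, P2 and P3 are
    themselves representable over Z[w, 1/3] with w a primitive cube root of
    unity, hence in every characteristic other than 3, so that the matrices B
    are needed in characteristic 3 only, where they have entries in GF(9).

    Conversely, row operations and column scalings bring any representation to
    the form [I | D], where D has the same zero entries as over GF(4) and has
    ones along a spanning forest of its support. Solving the equations given by
    the vanishing minors then shows 2 = 0 for the V_i and 3 <> 0 for the P_i. *)

Set Implicit Arguments.
Unset Strict Implicit.
Unset Printing Implicit Defensive.

Import GRing.Theory.
Local Open Scope ring_scope.

(** * Rank functions of minors *)

Section Rank.
Variables (T : finType) (M : matroid T).
Implicit Types B I J K X : {set T}.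

Definition rk X : nat := \max_(I in indep M | I \subset X) #|I|.

Lemma indep_leq_rk I X : I \in indep M -> I \subset X -> (#|I| <= rk X)%N.
Proof. by move=> iI sIX; rewrite /rk (bigD1 I) ?iI //= leq_maxl. Qed.

Lemma rk_attained X : exists I, [/\ I \in indep M, I \subset X & #|I| = rk X].
Proof.
have [|I /andP[iI sIX] rkX] :=
  @eq_bigmax_cond _ [pred I | (I \in indep M) && (I \subset X)]
    (fun I : {set T} => #|I|).
  by apply/card_gt0P; exists set0; rewrite inE indep0 sub0set.
by exists I; split=> //; rewrite -rkX.
Qed.

Lemma indep_extend_in I X : I \in indep M -> I \subset X ->
  exists K, [/\ K \in indep M, I \subset K, K \subset X & #|K| = rk X].
Proof.
move=> iI sIX; have [J [iJ sJX cJ]] := rk_attained X.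
have [|K [iK sIK sK cK]] := indep_extend iI iJ.
  by rewrite cJ indep_leq_rk.
exists K; split=> //; last by rewrite cK.
by rewrite (subset_trans sK) // subUset sIX.
Qed.

Lemma indep_rk I : (I \in indep M) = (rk I == #|I|).
Proof.
have [J [iJ sJI cJ]] := rk_attained I.
apply/idP/eqP => [iI|rkI].
  by apply/eqP; rewrite eqn_leq indep_leq_rk // -cJ subset_leq_card.
by have /eqP <- : J == I by rewrite eqEcard sJI cJ rkI leqnn.
Qed.

Lemma indep_basis I : (I \in indep M) = [exists B in bases M, I \subset B].
Proof.
apply/idP/exists_inP => [iI|[B /bases_indep iB sIB]]; last exact: indepS iB.
have [B maxB sIB] := @maxset_exists _ (mem (indep M)) I iI.
by exists B; rewrite ?inE.
Qed.

Lemma card_basis_rk B : B \in bases M -> #|B| = rk (ground M).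
Proof.
move=> bB; have iB := bases_indep bB.
apply/eqP; rewrite eqn_leq indep_leq_rk ?indep_sub //=.
by have [J [iJ _ <-]] := rk_attained (ground M); apply: indep_le_basis bB.
Qed.

Lemma basesE B : (B \in bases M) = (B \in indep M) && (#|B| == rk (ground M)).
Proof.
apply/idP/andP => [bB|[iB /eqP cB]].
  by rewrite bases_indep // card_basis_rk.
have [B0 bB0] := bases_ex M; apply: (card_basis bB0 iB).
by rewrite cB (card_basis_rk bB0).
Qed.

Lemma basis_meeting B0 X : B0 \in bases M -> exists B,
  [/\ B \in bases M, B0 :&: X \subset B, B \subset B0 :|: X
    & #|B :&: X| = rk X].
Proof.
move=> bB0; have iB0 := bases_indep bB0.
have [|K [iK sBXK sKX cK]] := indep_extend_in (indepS _ iB0) (subsetIr B0 X).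
  exact: subsetIl.
have [B [iB sKB sB cB]] := indep_extend iK iB0 (indep_le_basis iK bB0).
exists B; split; first exact: card_basis bB0 iB cB.
- exact: subset_trans sBXK sKB.
- by rewrite (subset_trans sB) // setUC setUS.
apply/eqP; rewrite eqn_leq -{2}cK subset_leq_card ?subsetI ?sKB // andbT.
by apply: indep_leq_rk; rewrite ?subsetIr // (indepS (subsetIl _ _) iB).
Qed.

End Rank.

Lemma rk_dual (T : finType) (M : matroid T) (X : {set T}) :
  X \subset ground M ->
  (rk (dual M) X + rk M (ground M) = #|X| + rk M (ground M :\: X))%N.
Proof.
move=> sX; apply/eqP; rewrite eqn_leq; apply/andP; split.
  have [I [+ sIX <-]] := rk_attained (dual M) X.
  rewrite inE => /andP[_ /exists_inP[B bB dIB]].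
  rewrite -(card_basis_rk bB) -(cardsID X B) addnA leq_add //.
    rewrite -(cardsID B X) setIC addnC leq_add2l subset_leq_card //.
    by rewrite subsetD sIX.
  apply: indep_leq_rk; first exact: indepS (subsetDl _ _) (bases_indep bB).
  by rewrite setSD // indep_sub // bases_indep.
have [B0 bB0] := bases_ex M.
have [B [bB _ _ <-]] := basis_meeting (ground M :\: X) bB0.
have sB := indep_sub (bases_indep bB).
have -> : B :&: (ground M :\: X) = B :\: X by rewrite setIDA (setIidPl sB).
rewrite -(card_basis_rk bB) -(cardsID X B) addnA leq_add2r.
rewrite -(cardsID B X) setIC addnC leq_add2r.
apply: indep_leq_rk (subsetDl _ _).
rewrite inE (subset_trans (subsetDl _ _) sX); apply/exists_inP; exists B => //.
by rewrite disjoint_sym -setI_eq0 setDE setICA setICr setI0.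
Qed.

Lemma rk_delete (T : finType) (M : matroid T) (D X : {set T}) :
  X \subset ground M :\: D -> rk (delete M D) X = rk M X.
Proof.
move=> sX; apply: eq_bigl => I; rewrite inE -andbA; congr (_ && _).
by apply/andb_idl => sIX; apply: subset_trans sIX sX.
Qed.

Section Minors.
Variables (T : finType) (C : {set T}).
Implicit Types (M N : matroid T) (D I X : {set T}).

Lemma rk_contract M X : C \subset ground M -> X \subset ground M :\: C ->
  (rk (contract M C) X + rk M C = rk M (X :|: C))%N.
Proof.
move=> sC sX; pose E := ground M.
have sEXE : E :\: C :\: X \subset E by rewrite setDDl subsetDl.
have EEC : E :\: (E :\: C) = C by rewrite setDDr setDv set0U (setIidPr sC).
have EEX : E :\: (E :\: C :\: X) = X :|: C.
  rewrite setDDl setDDr setDv set0U setUC; apply/setIidPr.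
  by rewrite subUset sC (subset_trans sX) ?subsetDl.
have := rk_dual (M := delete (dual M) C) sX.
rewrite /= !rk_delete ?subsetDl //=.
have := rk_dual (subsetDl E C); rewrite EEC.
have := rk_dual sEXE; rewrite EEX.
have := cardsID X (E :\: C); rewrite (setIidPr sX) /contract /E.
by clear; lia.
Qed.

Lemma minor_indepE M D I : C \subset ground M ->
  (I \in indep (delete (contract M C) D)) =
  (I \subset ground M :\: C :\: D) && (rk M (I :|: C) == #|I| + rk M C)%N.
Proof.
move=> sC; rewrite inE andbC indep_rk /=.
have [sI|//] := boolP (I \subset _ :\: D).
by rewrite -rk_contract ?eqn_add2r // (subset_trans sI) // subsetDl.
Qed.

Lemma minor_indep_eq M N D : C \subset ground M -> ground M = ground N ->
  (forall I, I \subset ground M :\: C :\: D ->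
    rk M (I :|: C) = rk N (I :|: C)) ->
  indep (delete (contract M C) D) = indep (delete (contract N C) D).
Proof.
move=> sC eqG eqrk; have rkC : rk M C = rk N C.
  by have := eqrk set0; rewrite set0U sub0set => ->.
apply/setP => I; rewrite !minor_indepE -?eqG // rkC.
by have [/eqrk->|] := boolP (I \subset _).
Qed.

End Minors.

Lemma sub_bases_rk_le (T : finType) (M N : matroid T) (B0 X : {set T})
    (e : T) (b : bool) :
  (forall B : {set T}, B \in bases M -> (e \in B) = b -> B \in bases N) ->
  B0 \in bases M -> (e \in B0) = b -> (e \in X) = b ->
  (rk M X <= rk N X)%N.
Proof.
move=> sub bB0 eB0 eX; have [B [bB sB0XB sB <-]] := basis_meeting X bB0.
have eB : (e \in B) = b.
  apply/idP/idP => [/(subsetP sB)|]; first by rewrite inE eB0 eX orbb.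
  by move=> eb; rewrite (subsetP sB0XB) // inE eB0 eX eb.
apply: indep_leq_rk (subsetIr _ _).
by apply: indepS (subsetIl _ _) _; apply: bases_indep; apply: sub.
Qed.

Lemma eq_bases_indep (T : finType) (M N : matroid T) :
  bases M = bases N -> indep M = indep N.
Proof. by move=> eqB; apply/setP => I; rewrite !indep_basis eqB. Qed.

(* Contracting e only sees the bases through e, and deleting e only those     *)
(* avoiding e.                                                                *)
Lemma eq_bases_off_minor_indep (T : finType) (M N : matroid T)
    (X B C D : {set T}) (e : T) :
  ground M = ground N ->
  (forall S : {set T}, S != X -> (S \in bases M) = (S \in bases N)) ->
  B \in bases M -> (e \in B) = (e \notin X) ->
  C \subset ground M -> [disjoint C & D] -> e \in (if e \in X then D else C) ->
  indep (delete (contract M C) D) = indep (delete (contract N C) D).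
Proof.
move=> eqG eqB bB eB sC dCD eCD.
have offX (S : {set T}) : (e \in S) = (e \notin X) -> S != X.
  by move=> eS; apply: contra_eq_neq eS => ->; case: (e \in X).
apply: minor_indep_eq => // I sI.
have eIC : (e \in I :|: C) = (e \notin X).
  rewrite inE; case: ifP eCD => [_ eD|_ eC]; last by rewrite eC orbT.
  rewrite (disjointFl dCD eD) orbF; apply/negP => /(subsetP sI).
  by rewrite !inE eD.
apply/eqP; rewrite eqn_leq (sub_bases_rk_le _ bB eB eIC) /=; last first.
  by move=> S bS /offX/eqB <-.
apply: (sub_bases_rk_le (B0 := B) _ _ eB eIC); last by rewrite -eqB ?offX.
by move=> S bS /offX/eqB ->.
Qed.

Lemma isomorphic_bij (T U : finType) (M : matroid T) (N : matroid U)
    (f : T -> U) :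
  bijective f -> ground M = [set: T] -> ground N = [set: U] ->
  (forall I : {set T}, (f @: I \in indep N) = (I \in indep M)) ->
  isomorphic M N.
Proof.
move=> [g fK gK] gM gN fI.
have inM x : x \in ground M by rewrite gM inE.
have inN y : y \in ground N by rewrite gN inE.
pose f' (x : {x | x \in ground M}) : {y | y \in ground N} :=
  exist _ (f (val x)) (inN (f (val x))).
pose g' (y : {y | y \in ground N}) : {x | x \in ground M} :=
  exist _ (g (val y)) (inM (g (val y))).
exists f'; first by exists g' => [x|y]; apply: val_inj; rewrite /= ?fK ?gK.
by move=> I; rewrite -fI -imset_comp.
Qed.

Lemma isomorphic_dual (T : finType) (M : matroid T) (p : T -> T) :
  ground M = [set: T] -> injective p ->
  (forall B : {set T}, B \in bases M -> ~: (p @: B) \in bases M) ->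
  isomorphic M (dual M).
Proof.
move=> gM p_inj pB; pose co (B : {set T}) := ~: (p @: B).
have co_inj : injective co by move=> B B' /setC_inj/(imset_inj p_inj).
have co_bases : co @: bases M = bases M.
  apply/eqP; rewrite eqEcard card_imset // leqnn andbT.
  by apply/subsetP => _ /imsetP[B bB ->]; apply: pB.
apply: (isomorphic_bij (injF_bij p_inj)) => // I.
rewrite inE gM subsetT indep_basis /=.
apply/exists_inP/exists_inP => [[B]|[B bB sIB]].
  rewrite -{1}co_bases => /imsetP[B' bB' ->].
  rewrite disjoints_subset setCK => sIB'; exists B' => //.
  apply/subsetP => x xI; rewrite -(mem_imset _ _ p_inj).
  by apply: (subsetP sIB'); rewrite mem_imset.
exists (co B); first exact: pB.
by rewrite disjoints_subset setCK imsetS.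
Qed.

(** * Representations *)

Section FamilySpan.
Variables (F : fieldType) (T : finType) (vT : vectType F) (v : T -> vT).
Implicit Types (X Y I : {set T}) (U : {vspace vT}).

Definition span_on X : {vspace vT} := <<[seq v i | i <- enum X]>>%VS.

Definition free_on X : bool := free [seq v i | i <- enum X].

Lemma free_onE X : free_on X = (\dim (span_on X) == #|X|).
Proof. by rewrite /free_on /free size_map -cardE. Qed.

Lemma mem_span_on X i : i \in X -> v i \in span_on X.
Proof. by move=> iX; apply/memv_span/map_f; rewrite mem_enum. Qed.

Lemma span_on_subvP X U :
  reflect {in X, forall i, v i \in U} (span_on X <= U)%VS.
Proof.
apply: (iffP span_subvP) => [vU i iX|vU _ /mapP[i + ->]].
  by apply/vU/map_f; rewrite mem_enum.
by rewrite mem_enum; apply: vU.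
Qed.

Lemma span_onS X Y : X \subset Y -> (span_on X <= span_on Y)%VS.
Proof. by move=> sXY; apply/span_on_subvP => i /(subsetP sXY)/mem_span_on. Qed.

Lemma span_onU X Y : span_on (X :|: Y) = (span_on X + span_on Y)%VS.
Proof.
apply/eqP; rewrite eqEsubv subv_add !span_onS ?subsetUl ?subsetUr // !andbT.
apply/span_on_subvP => i; rewrite inE => /orP[] /mem_span_on.
  by apply/subvP; rewrite addvSl.
by apply/subvP; rewrite addvSr.
Qed.

Lemma span_on_seq X (s : seq T) :
  X =i s -> span_on X = <<[seq v i | i <- s]>>%VS.
Proof. by move=> Xs; apply/eq_span/eq_mem_map => x; rewrite mem_enum. Qed.

Lemma free_on_seq X (s : seq T) : uniq s -> X =i s ->
  free_on X = free [seq v i | i <- s].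
Proof.
move=> us Xs; apply/perm_free/perm_map/uniq_perm; rewrite ?enum_uniq // => x.
by rewrite mem_enum.
Qed.

Lemma free_onU1 x X : x \notin X ->
  free_on (x |: X) = (v x \notin span_on X) && free_on X.
Proof.
move=> xX; rewrite -free_cons; apply: (@free_on_seq _ (x :: enum X)).
  by rewrite /= mem_enum xX enum_uniq.
by move=> y; rewrite !inE mem_enum.
Qed.

End FamilySpan.

Lemma free_on_imset (F : fieldType) (S T : finType) (vT : vectType F)
    (v : T -> vT) (h : S -> T) (X : {set S}) : injective h ->
  free_on v (h @: X) = free_on (v \o h) X.
Proof.
move=> h_inj; rewrite (@free_on_seq _ _ _ _ _ [seq h i | i <- enum X]).
- by rewrite -map_comp.
- by rewrite map_inj_uniq ?enum_uniq.
move=> x; apply/imsetP/mapP => -[i iX ->]; exists i => //.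
  by rewrite mem_enum.
by rewrite -mem_enum.
Qed.

Lemma eq_free_on (F : fieldType) (T : finType) (vT : vectType F) (v w : T -> vT)
    (X : {set T}) : {in X, v =1 w} -> free_on v X = free_on w X.
Proof.
by move=> vw; congr free; apply/eq_in_map => i; rewrite mem_enum; apply: vw.
Qed.

Lemma span_on_linear (F : fieldType) (T : finType) (vT wT : vectType F)
    (f : 'Hom(vT, wT)) (v : T -> vT) (X : {set T}) :
  span_on (f \o v) X = (f @: span_on v X)%VS.
Proof. by rewrite limg_span -map_comp. Qed.

Lemma free_on_linear (F : fieldType) (T : finType) (vT wT : vectType F)
    (f : 'Hom(vT, wT)) (v : T -> vT) (X : {set T}) : lker f == 0%VS ->
  free_on (f \o v) X = free_on v X.
Proof.
by move=> /eqP kerf; rewrite !free_onE span_on_linear limg_dim_eq // kerf capv0.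
Qed.

Lemma column_indepE (F : fieldType) (r n : nat) (A : 'M[F]_(r, n))
    (S : {set 'I_n}) :
  (S \in column_indep A) = free_on (fun j => col j A) S.
Proof. by rewrite inE. Qed.

Section Representable.
Variable F : fieldType.

Definition realizes (T : finType) (r : nat) (v : T -> 'cV[F]_r)
    (M : matroid T) : Prop :=
  forall I : {set T}, I \subset ground M -> (I \in indep M) = free_on v I.

Lemma realizes_representable (T : finType) (M : matroid T) (r : nat)
    (v : T -> 'cV[F]_r) :
  realizes v M -> representable F M.
Proof.
move=> vM; pose G := ground M.
pose A : 'M[F]_(r, #|G|) := \matrix_(i, j) v (enum_val j) i 0.
exists r, #|G|, A.
pose f (x : {x | x \in G}) : {y | y \in ground (column_matroid A)} :=
  exist _ (enum_rank_in (valP x) (val x)) (in_setT _).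
pose g (y : {y | y \in ground (column_matroid A)}) : {x | x \in G} :=
  exist _ (enum_val (val y)) (enum_valP (val y)).
have fK : cancel f g.
  by move=> x; apply: val_inj; rewrite /= enum_rankK_in ?(valP x).
have gK : cancel g f by move=> y; apply: val_inj; rewrite /= enum_valK_in.
exists f; first by exists g.
move=> I; rewrite vM; last by apply/subsetP => _ /imsetP[x _ ->]; apply: valP.
rewrite [LHS]column_indepE (@free_on_imset _ _ _ _ _ (val \o f)); last first.
  exact: inj_comp val_inj (can_inj fK).
rewrite free_on_imset; last exact: val_inj.
apply: eq_free_on => x _; apply/colP => i.
by rewrite !mxE /= enum_rankK_in ?(valP x).
Qed.

Lemma representable_realizes (T : finType) (M : matroid T) :
  representable F M -> exists (r : nat) (v : T -> 'cV[F]_r), realizes v M.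
Proof.
move=> [r [n [A [f [g fK _] fP]]]].
pose v (x : T) : 'cV[F]_r := if insub x is Some y then col (val (f y)) A else 0.
exists r, v => I sI.
pose J : {set {x | x \in ground M}} := [set x | val x \in I].
have -> : I = [set val x | x in J].
  apply/setP => x; apply/idP/imsetP => [xI|[y + ->]]; last by rewrite inE.
  by exists (Sub x (subsetP sI _ xI)); rewrite ?inE SubK.
rewrite -fP [LHS]column_indepE.
rewrite (@free_on_imset _ _ _ _ _ (val \o f)); last first.
  exact: inj_comp val_inj (can_inj fK).
rewrite free_on_imset; last exact: val_inj.
by apply: eq_free_on => x _; rewrite /v /= valK.
Qed.

Lemma eq_representable (T : finType) (M N : matroid T) :
  ground M = ground N -> indep M = indep N ->
  representable F M -> representable F N.
Proof.
move=> eqG eqI /representable_realizes[r [v vM]].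
by apply: (@realizes_representable _ _ r v) => I; rewrite -eqG -eqI; apply: vM.
Qed.

Lemma column_realizes (r n : nat) (A : 'M[F]_(r, n)) :
  realizes (fun j => col j A) (column_matroid A).
Proof. by move=> I _; apply: column_indepE. Qed.

Lemma column_representable (r n : nat) (A : 'M[F]_(r, n)) :
  representable F (column_matroid A).
Proof. exact: realizes_representable (@column_realizes _ _ A). Qed.

Lemma realizes_column_indep (r n : nat) (M : matroid 'I_n) (A : 'M[F]_(r, n)) :
  ground M = [set: 'I_n] -> realizes (fun j => col j A) M ->
  column_indep A = indep M.
Proof. by move=> gM vM; apply/setP => I; rewrite vM ?gM ?subsetT // inE. Qed.

Lemma realizes_span_on (T : finType) (M : matroid T) (r : nat)
    (v : T -> 'cV[F]_r) (I X : {set T}) :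
  realizes v M -> I \in indep M -> I \subset X -> X \subset ground M ->
  #|I| = rk M X -> span_on v I = span_on v X.
Proof.
move=> vM iI sIX sX cI; apply/eqP; rewrite eqEsubv span_onS //=.
apply/span_on_subvP => x xX.
have [xI|xI] := boolP (x \in I); first exact: mem_span_on.
apply: contraT => vx; suff: (#|x |: I| <= rk M X)%N.
  by rewrite cardsU1 xI -cI add1n ltnn.
have sxIX : x |: I \subset X by rewrite subUset sub1set xX.
apply: indep_leq_rk => //.
by rewrite vM ?(subset_trans sxIX) // free_onU1 // vx -vM // (indep_sub iI).
Qed.

Lemma realizes_rk (T : finType) (M : matroid T) (r : nat) (v : T -> 'cV[F]_r)
    (X : {set T}) :
  realizes v M -> X \subset ground M -> rk M X = \dim (span_on v X).
Proof.
move=> vM sX; have [I [iI sIX cI]] := rk_attained M X.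
rewrite -(realizes_span_on vM iI sIX sX cI) -cI; apply/esym/eqP.
by rewrite -free_onE -vM // (indep_sub iI).
Qed.

(* Contracting C amounts to projecting along the span of its vectors.         *)
Lemma representable_minor (T : finType) (M : matroid T) (C D : {set T}) :
  C \subset ground M -> representable F M ->
  representable F (delete (contract M C) D).
Proof.
move=> sC /representable_realizes[r [v vM]].
pose V := span_on v C; pose f : 'End('cV[F]_r) := (\1 - projv V)%VF.
have fE u : f u = u - projv V u by rewrite add_lfunE opp_lfunE id_lfunE.
have kerf : lker f = V.
  apply/vspaceP => u; rewrite memv_ker fE subr_eq0; apply/eqP/idP => [->|uV].
    exact: memv_proj.
  by rewrite projv_id.
apply: (@realizes_representable _ _ r (f \o v)) => I sI.
have sIC : I :|: C \subset ground M.
  by rewrite subUset sC (subset_trans sI) // /= setDDl subsetDl.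
rewrite minor_indepE // sI !(realizes_rk vM) // free_onE span_on_linear /=.
have := limg_ker_dim f (span_on v (I :|: C)).
rewrite kerf span_onU limgD (_ : (f @: span_on v C)%VS = 0%VS); last first.
  by apply/eqP; rewrite -lkerE kerf subvv.
by rewrite addv0 (capv_idPr (addvSr _ _)) -/V => <-; rewrite addnC eqn_add2r.
Qed.

(* The vectors are replaced by their coordinates in the basis h.              *)
Lemma representable_standard (T : finType) (M : matroid T) (r : nat)
    (h : 'I_r -> T) :
  ground M = [set: T] -> injective h -> h @: [set: 'I_r] \in bases M ->
  representable F M ->
  exists2 v : T -> 'cV[F]_r, realizes v M & forall i, v (h i) = delta_mx i 0.
Proof.
move=> gM h_inj bh /representable_realizes[m [w wM]].
have sM (I : {set T}) : I \subset ground M by rewrite gM.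
pose X : r.-tuple 'cV[F]_m := [tuple w (h i) | i < r].
have nthX (i : 'I_r) : X`_i = w (h i) by rewrite -tnth_nth tnth_mktuple.
have spanX : span_on w (h @: [set: 'I_r]) = <<X>>%VS.
  rewrite (@span_on_seq _ _ _ w _ [seq h i | i <- enum 'I_r]) => [|x].
    by rewrite -map_comp.
  by apply/imsetP/mapP => -[i _ ->]; exists i; rewrite ?mem_enum.
have freeX : free X.
  rewrite /free -spanX size_tuple -[X in _ == X]card_ord -cardsT.
  by rewrite -(card_imset _ h_inj) -free_onE -wM // bases_indep.
have wX x : w x \in <<X>>%VS.
  rewrite -spanX (realizes_span_on wM (bases_indep bh) (sM _) (subxx _)).
    by rewrite mem_span_on // gM inE.
  exact: card_basis_rk.
pose v x : 'cV[F]_r := \col_i coord X i (w x).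
pose f : 'Hom('cV[F]_r, 'cV[F]_m) :=
  linfun (mulmx (\matrix_(l, i) w (h i) l 0)).
have fE u : f u = \sum_i u i 0 *: X`_i.
  apply/colP => l; rewrite lfunE /= !mxE summxE; apply: eq_bigr => i _.
  by rewrite nthX !mxE mulrC.
have fv x : f (v x) = w x.
  rewrite fE [RHS](coord_span (wX x)); apply: eq_bigr => i _.
  by rewrite mxE.
have kerf : lker f == 0%VS.
  rewrite -subv0; apply/subvP => u; rewrite memv_ker fE memv0 => /eqP fu0.
  apply/eqP/colP => i; rewrite mxE.
  by have /freeP/(_ (fun i => u i 0))-> := freeX.
exists v => [I _|i].
  rewrite wM // -(free_on_linear v I kerf).
  by apply: eq_free_on => x _; rewrite /= fv.
by apply/colP => k; rewrite !mxE -nthX coord_free // eqxx andbT eq_sym.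
Qed.

End Representable.

(** * Matroids of matrices *)

Lemma free_on_scale (F : fieldType) (T : finType) (vT : vectType F)
    (v : T -> vT) (c : T -> F) (X : {set T}) : (forall i, c i != 0) ->
  free_on (fun i => c i *: v i) X = free_on v X.
Proof.
move=> c0; rewrite !free_onE; congr (\dim _ == _); apply/eqP.
rewrite eqEsubv; apply/andP; split; apply/span_on_subvP => i iX.
  by apply: memvZ; apply: mem_span_on.
by rewrite -[v i](scalerK (c0 i)) memvZ // (mem_span_on (fun i => c i *: v i)).
Qed.

Section ColumnMatroid.
Variables (F : fieldType) (r n : nat).
Implicit Types (A : 'M[F]_(r, n)) (S X : {set 'I_n}).

Lemma column_indep_leq A S : S \in column_indep A -> (#|S| <= r)%N.
Proof.
rewrite column_indepE free_onE => /eqP <-.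
by rewrite (leq_trans (dimvS (subvf _))) // dimvf /dim /= muln1.
Qed.

Lemma column_basesE A X S : X \in column_indep A -> #|X| = r ->
  (S \in bases (column_matroid A)) = (S \in column_indep A) && (#|S| == r).
Proof.
move=> iX cX; rewrite basesE.
suff -> : rk (column_matroid A) [set: 'I_n] = r by [].
have [I [iI _ cI]] := rk_attained (column_matroid A) [set: 'I_n].
apply/eqP; rewrite eqn_leq -{1}cI (column_indep_leq iI).
by rewrite -{1}cX (indep_leq_rk (M := column_matroid A)).
Qed.

Lemma column_indep_mul A (L : 'M_r) : L \in unitmx ->
  column_indep (L *m A) = column_indep A.
Proof.
move=> uL; pose f : 'End('cV[F]_r) := linfun (mulmx L).
have kerf : lker f == 0%VS.
  by apply/lker0P => u w; rewrite !lfunE /=; apply: (can_inj (mulKmx uL)).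
apply/setP => S; rewrite !column_indepE -[RHS](free_on_linear _ _ kerf).
by apply: eq_free_on => j _; rewrite /= lfunE /= !colE mulmxA.
Qed.

Lemma column_indep_scale A (x : 'rV_r) (y : 'rV_n) :
  (forall i, x 0 i != 0) -> (forall j, y 0 j != 0) ->
  column_indep (\matrix_(i, j) (x 0 i * A i j * y 0 j)) = column_indep A.
Proof.
move=> x0 y0; have ux : diag_mx x \in unitmx.
  by rewrite unitmxE det_diag unitfE; apply/prodf_neq0 => i _.
rewrite -(column_indep_mul A ux); apply/setP => S; rewrite !column_indepE.
rewrite -[RHS](free_on_scale _ _ y0); apply: eq_free_on => j _.
by apply/colP => i; rewrite mul_diag_mx !mxE mulrC.
Qed.

Lemma free_on_col_unit (A : 'M[F]_r) :
  free_on (fun j => col j A) [set: 'I_r] = (A \in unitmx).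
Proof.
pose X := [tuple col j A | j < r].
have nthX (j : 'I_r) : X`_j = col j A by rewrite -tnth_nth tnth_mktuple.
have sumX (u : 'I_r -> F) : \sum_i u i *: X`_i = A *m \col_i u i.
  apply/colP => k; rewrite summxE mxE; apply: eq_bigr => i _.
  by rewrite nthX !mxE mulrC.
rewrite (@free_on_seq _ _ _ _ _ (enum 'I_r)) ?enum_uniq //; last first.
  by move=> j; rewrite inE mem_enum.
rewrite -[LHS]/(free X); apply/freeP/idP => [X0|uA u].
  rewrite unitmxE unitfE -det_tr; apply/det0P => -[u /eqP + uA]; apply.
  apply/rowP => i; rewrite mxE; apply: (X0 (fun i => u 0 i)).
  have colu : \col_i u 0 i = u^T by apply/colP => k; rewrite !mxE.
  by rewrite sumX colu -[LHS]trmxK trmx_mul trmxK uA trmx0.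
rewrite sumX => /(congr1 (mulmx (invmx A))); rewrite mulKmx // mulmx0.
by move=> /colP u0 i; have := u0 i; rewrite !mxE.
Qed.

Lemma column_indep_det A (g : 'I_r -> 'I_n) : injective g ->
  (g @: [set: 'I_r] \in column_indep A) =
  (\det (\matrix_(i, j) A i (g j)) != 0).
Proof.
move=> g_inj; rewrite column_indepE free_on_imset //.
rewrite -unitfE -unitmxE -free_on_col_unit; apply: eq_free_on => j _.
by apply/colP => i; rewrite !mxE.
Qed.

End ColumnMatroid.

(** * Minors indexed by sequences *)

Definition fun_mx (F : fieldType) (r n : nat) (a : nat -> nat -> F) :
  'M[F]_(r, n) := \matrix_(i, j) a i j.

Definition minor (F : fieldType) (r : nat) (a : nat -> nat -> F)
    (s : seq nat) : F :=
  \det (\matrix_(i < r, k < r) a i (nth 0%N s k)).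

Fixpoint combinations (T : Type) (k : nat) (s : seq T) : seq (seq T) :=
  match k, s with
  | 0, _ => [:: [::]]
  | _.+1, [::] => [::]
  | k'.+1, x :: s' =>
      [seq x :: t | t <- combinations k' s'] ++ combinations k s'
  end.

Lemma mem_combinations (T : eqType) (k : nat) (s t : seq T) :
  (t \in combinations k s) = subseq t s && (size t == k).
Proof.
elim: s k t => [|x s IHs] [|k] t; try by case: t.
  by rewrite inE; case: t => [|y t]; rewrite /= ?andbF.
rewrite mem_cat IHs; apply/orP/andP => [[/mapP[u + ->]|/andP[ts ->]]|[]].
- by rewrite IHs /= eqxx eqSS => /andP[].
- by rewrite (subseq_trans ts) ?subseq_cons.
case: t => [|y t] //=; have [->|yx] := eqVneq y x; last by right; apply/andP.
by move=> ts ct; left; rewrite map_f // IHs ts.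
Qed.

Definition ord_set (n : nat) (s : seq nat) : {set 'I_n} :=
  [set i : 'I_n | (i : nat) \in s].

Section OrdSet.
Variables (r n : nat).

Lemma combinations_ord_set (S : {set 'I_n}) : #|S| = r ->
  exists2 s, s \in combinations r (iota 0 n) & S = ord_set n s.
Proof.
move=> cS; exists [seq val i | i <- enum S].
  rewrite mem_combinations size_map -cardE cS eqxx andbT -val_enum_ord.
  by apply: map_subseq; rewrite enumT; apply: filter_subseq.
by apply/setP => i; rewrite inE mem_map ?mem_enum //; apply: val_inj.
Qed.

Lemma ord_set_imset s : s \in combinations r (iota 0 n) ->
  exists2 g : 'I_r -> 'I_n, injective g /\ (forall k, g k = nth 0%N s k :> nat)
    & ord_set n s = g @: [set: 'I_r].
Proof.
rewrite mem_combinations => /andP[ss /eqP cs].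
have us : uniq s by apply: subseq_uniq ss (iota_uniq 0 n).
have ltn (k : 'I_r) : (nth 0 s k < n)%N.
  have /(mem_subseq ss) : nth 0%N s k \in s by rewrite mem_nth ?cs.
  by rewrite mem_iota.
exists (fun k => Ordinal (ltn k)).
  split=> // k l /(congr1 val)/eqP /=; rewrite nth_uniq ?cs // => /eqP.
  exact: val_inj.
apply/setP => i; rewrite inE.
apply/idP/imsetP => [/(nthP 0%N)[k ks ki]|[k _ ->]].
  by rewrite cs in ks; exists (Ordinal ks); rewrite ?inE //; apply: val_inj.
by rewrite mem_nth ?cs.
Qed.

Lemma card_ord_set s : s \in combinations r (iota 0 n) -> #|ord_set n s| = r.
Proof.
by case/ord_set_imset => g [g_inj _] ->; rewrite card_imset // cardsT card_ord.
Qed.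

Lemma column_indep_minor (F : fieldType) (a : nat -> nat -> F) s :
  s \in combinations r (iota 0 n) ->
  (ord_set n s \in column_indep (fun_mx r n a)) = (minor r a s != 0).
Proof.
case/ord_set_imset => g [g_inj gs] ->; rewrite column_indep_det //.
by congr (\det _ != 0); apply/matrixP => i j; rewrite !mxE gs.
Qed.

End OrdSet.

Section Laplace.
Variables (T : Type) (zero one : T) (add mul : T -> T -> T) (opp : T -> T).

Fixpoint laplace (n : nat) (a : nat -> nat -> T) : T :=
  if n is m.+1 then
    foldr (fun j => add (mul (if odd j then opp (a 0%N j) else a 0%N j)
                             (laplace m (fun i k => a i.+1 (bump j k)))))
          zero (iota 0 n)
  else one.

Lemma laplace_det (R : comNzRingType) (phi : T -> R) :
  phi zero = 0 -> phi one = 1 -> {morph phi : x y / add x y >-> x + y} ->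
  {morph phi : x y / mul x y >-> x * y} -> {morph phi : x / opp x >-> - x} ->
  forall n (a : nat -> nat -> T),
    phi (laplace n a) = \det (\matrix_(i < n, j < n) phi (a i j)).
Proof.
move=> phi0 phi1 phiD phiM phiN; elim=> [|n IHn] a; first by rewrite det_mx00.
rewrite (expand_det_row _ ord0) [laplace _ _]/(foldr _ _ _).
transitivity (\sum_(j <- iota 0 n.+1) phi (a 0%N j) *
  ((-1) ^+ j * phi (laplace n (fun i k => a i.+1 (bump j k))))).
  elim: (iota 0 n.+1) => [|j s IHs] /=; first by rewrite big_nil.
  rewrite big_cons phiD phiM IHs; congr (_ + _); rewrite mulrCA -signr_odd.
  by case: (odd j); rewrite ?phiN ?mulN1r ?mul1r ?mulNr.
rewrite -/(index_iota 0 n.+1) big_mkord; apply: eq_bigr => j _.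
rewrite mxE /cofactor IHn /= add0n; congr (_ * (_ * \det _)).
by apply/matrixP => i k; rewrite !mxE.
Qed.

End Laplace.

Lemma minor_laplace (F : fieldType) (r : nat) (a : nat -> nat -> F)
    (s : seq nat) :
  minor r a s = laplace 0 1 +%R *%R -%R r (fun i k => a i (nth 0%N s k)).
Proof. by rewrite (laplace_det (phi := id)). Qed.

(** * Normal forms of representations *)

Section StandardEntries.
Variables (F : fieldType) (T : finType) (M : matroid T) (r : nat).
Variables (h : 'I_r -> T) (v : T -> 'cV[F]_r).
Hypotheses (gM : ground M = [set: T]) (bh : h @: [set: 'I_r] \in bases M).
Hypothesis vM : realizes v M.
Hypothesis vh : forall i, v (h i) = delta_mx i 0.

Lemma mem_standard_hyperplane (i : 'I_r) (u : 'cV[F]_r) :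
  (u \in span_on v (h @: [set~ i])) = (u i 0 == 0).
Proof.
pose f : 'Hom('cV[F]_r, 'M[F]_1) := linfun (mulmx (delta_mx 0 i)).
have fE w : (f w == 0) = (w i 0 == 0).
  rewrite lfunE /= -rowE.
  apply/eqP/eqP => [/matrixP/(_ 0 0)|wi]; rewrite ?mxE //.
  by apply/matrixP => j k; rewrite !ord1 !mxE.
have sub : (span_on v (h @: [set~ i]) <= lker f)%VS.
  apply/span_on_subvP => _ /imsetP[k + ->]; rewrite !inE memv_ker fE vh => ki.
  by rewrite mxE (eq_sym i) (negbTE ki).
apply/idP/idP => [/(subvP sub)|/eqP ui]; first by rewrite memv_ker fE.
rewrite [u]matrix_sum_delta; apply: memv_suml => k _; rewrite big_ord1.
have [->|ki] := eqVneq k i; first by rewrite ui scale0r mem0v.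
by rewrite -vh memvZ // mem_span_on // imset_f // !inE.
Qed.

Lemma standard_entry_eq0 (i : 'I_r) (x : T) : x \notin h @: [set~ i] ->
  (v x i 0 == 0) = (x |: h @: [set~ i] \notin indep M).
Proof.
move=> xh; have ih : h @: [set~ i] \in indep M.
  by apply: indepS (bases_indep bh); apply/imsetS/subsetP.
rewrite vM ?gM ?subsetT // free_onU1 // mem_standard_hyperplane.
by rewrite -vM ?gM ?subsetT // ih andbT negbK.
Qed.

End StandardEntries.

Lemma standard_entries_eq0 (F G : fieldType) (T : finType) (M : matroid T)
    (r : nat) (h : 'I_r -> T) (v : T -> 'cV[F]_r) (w : T -> 'cV[G]_r) :
  ground M = [set: T] -> h @: [set: 'I_r] \in bases M ->
  realizes v M -> (forall i, v (h i) = delta_mx i 0) ->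
  realizes w M -> (forall i, w (h i) = delta_mx i 0) ->
  forall x i, (v x i 0 == 0) = (w x i 0 == 0).
Proof.
move=> gM bh vM vh wM wh x i.
have [/imsetP[k _ ->]|xh] := boolP (x \in h @: [set~ i]).
  by rewrite vh wh !mxE andbT; case: (i == k); rewrite ?eqxx ?oner_eq0.
by rewrite (standard_entry_eq0 gM bh vM vh) // (standard_entry_eq0 gM bh wM wh).
Qed.

(* Leaves come first: each pair, seen as an edge between a row and a column,  *)
(* has an end that does not occur further down the list.                      *)
Fixpoint forest (I J : eqType) (s : seq (I * J)) : bool :=
  if s is p :: s' then
    ((p.1 \notin unzip1 s') || (p.2 \notin unzip2 s')) && forest s'
  else true.

Lemma forest_scaling (F : fieldType) (I J : eqType) (b : I -> J -> F)
    (s : seq (I * J)) : forest s -> {in s, forall p, b p.1 p.2 != 0} ->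
  exists (x : I -> F) (y : J -> F),
  [/\ forall i, x i != 0, forall j, y j != 0
    & {in s, forall p, x p.1 * b p.1 p.2 * y p.2 = 1}].
Proof.
elim: s => [|[i j] s IHs] /=.
  by move=> _ _; exists (fun=> 1), (fun=> 1); split=> // k; rewrite oner_neq0.
case/andP => new /IHs{}IHs b0.
have [|x [y [x0 y0 xy]]] := IHs.
  by move=> p ps; apply: b0; rewrite inE ps orbT.
have bij : b i j != 0 := b0 (i, j) (mem_head _ _).
have [is_new|j_new] := orP new.
  exists [eta x with i |-> (b i j * y j)^-1], y; split=> // [k|p].
    by rewrite /=; case: ifP => // _; rewrite invr_eq0 mulf_neq0.
  rewrite inE => /orP[/eqP->|ps] /=.
    by rewrite eqxx -mulrA mulVf ?mulf_neq0.
  by rewrite ifN ?xy //; apply: contraNneq is_new => <-; apply: map_f.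
exists x, [eta y with j |-> (x i * b i j)^-1]; split=> // [k|p].
  by rewrite /=; case: ifP => // _; rewrite invr_eq0 mulf_neq0.
rewrite inE => /orP[/eqP->|ps] /=.
  by rewrite eqxx mulfV ?mulf_neq0.
by rewrite ifN ?xy //; apply: contraNneq j_new => <-; apply: map_f.
Qed.

Section NormalForm.
Variables (F G : fieldType) (r n : nat) (a : nat -> nat -> G).
Hypothesis rn : (r <= n)%N.
Hypothesis a_id : forall i j, (i < r)%N -> (j < r)%N -> a i j = (i == j)%:R.

Let M := column_matroid (fun_mx r n a).

Lemma representable_standard_mx : representable F M ->
  exists2 b : nat -> nat -> F, column_indep (fun_mx r n b) = indep M &
    forall i j, (i < r)%N -> (j < n)%N -> (b i j == 0) = (a i j == 0).
Proof.
pose h := widen_ord rn; have gM : ground M = [set: 'I_n] by [].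
have h_inj : injective h by move=> i j /(congr1 val) /= /val_inj.
have ah i : col (h i) (fun_mx r n a) = delta_mx i 0.
  by apply/colP => k; rewrite !mxE a_id //= andbT.
have ih : h @: [set: 'I_r] \in indep M.
  rewrite [_ \in _]column_indepE free_on_imset //.
  rewrite -(@eq_free_on _ _ _ (fun j => col j 1%:M)) => [|i _].
    by rewrite free_on_col_unit unitmx1.
  by rewrite /= ah; apply/colP => k; rewrite !mxE andbT.
have bh : h @: [set: 'I_r] \in bases M.
  have ch : #|h @: [set: 'I_r]| = r by rewrite card_imset // cardsT card_ord.
  by rewrite (column_basesE _ ih ch) ch eqxx andbT.
move=> /(representable_standard gM h_inj bh)[v vM vh].
have v0 := standard_entries_eq0 gM bh vM vh (@column_realizes _ _ _ _) ah.
pose b i j : F :=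
  if insub i is Some i' then if insub j is Some j' then v j' i' 0 else 0 else 0.
have bE (i : 'I_r) (j : 'I_n) : b i j = v j i 0 by rewrite /b !valK.
exists b => [|i j ir jn].
  apply: realizes_column_indep => // I sI; rewrite vM //.
  by apply: eq_free_on => j _; apply/colP => i; rewrite !mxE bE.
by rewrite (bE (Ordinal ir) (Ordinal jn)) v0 !mxE.
Qed.

Lemma representable_normal_form (s : seq (nat * nat)) : forest s ->
  {in s, forall p, [&& (p.1 < r)%N, (p.2 < n)%N & a p.1 p.2 != 0]} ->
  representable F M ->
  exists b : nat -> nat -> F, [/\ column_indep (fun_mx r n b) = indep M,
    forall i j, (i < r)%N -> (j < n)%N -> (b i j == 0) = (a i j == 0)
  & {in s, forall p, b p.1 p.2 = 1}].
Proof.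
move=> fs as0 /representable_standard_mx[b <- b0].
have [|x [y [x0 y0 xy]]] := forest_scaling fs (b := b).
  by move=> p /as0/and3P[pr pn]; rewrite b0.
exists (fun i j => x i * b i j * y j); split=> // [|i j ir jn]; last first.
  by rewrite !mulf_eq0 (negbTE (x0 i)) (negbTE (y0 j)) orbF b0.
rewrite -[RHS](column_indep_scale _ (x := \row_i x i) (y := \row_j y j)).
- by congr column_indep; apply/matrixP => i j; rewrite !mxE.
- by move=> i; rewrite mxE.
by move=> j; rewrite mxE.
Qed.

End NormalForm.

(** * Matrices over quadratic rings *)

(* A pair (x, y) of integers stands for x + y t, where t is an element of a   *)
(* field such that t ^+ 2 = square, in which null vanishes and nonnull does   *)
(* not.                                                                       *)
Record quadratic := Quadratic { square : int * int; null : int; nonnull : int }.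

Definition quad_mul (Q : quadratic) (x y : int * int) : int * int :=
  (x.1 * y.1 + (square Q).1 * (x.2 * y.2),
   x.1 * y.2 + x.2 * y.1 + (square Q).2 * (x.2 * y.2)).

Definition quad_norm (Q : quadratic) (x : int * int) : int :=
  x.1 * x.1 + (square Q).2 * (x.1 * x.2) - (square Q).1 * (x.2 * x.2).

Definition quad_eq0 (Q : quadratic) (x : int * int) : bool :=
  (null Q %| x.1)%Z && (null Q %| x.2)%Z.

(* By Bezout, x can only vanish together with nonnull.                        *)
Definition quad_neq0 (Q : quadratic) (x : int * int) : bool :=
  (gcdz (quad_norm Q x) (null Q) %| nonnull Q)%Z.

Section QuadraticEvaluation.
Variables (F : fieldType) (Q : quadratic) (t : F).

Definition quad_eval (x : int * int) : F := x.1%:~R + x.2%:~R * t.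

Definition quad_model : Prop :=
  [/\ t ^+ 2 = quad_eval (square Q), (null Q)%:~R = 0 :> F
    & (nonnull Q)%:~R != 0 :> F].

Lemma quad_eval0 : quad_eval 0 = 0.
Proof. by rewrite /quad_eval mul0r addr0. Qed.

Lemma quad_eval1 : quad_eval (1, 0) = 1.
Proof. by rewrite /quad_eval mul0r addr0. Qed.

Lemma quad_evalD : {morph quad_eval : x y / x + y}.
Proof. by move=> x y; rewrite /quad_eval /= !intrD; ring. Qed.

Lemma quad_evalN : {morph quad_eval : x / - x}.
Proof. by move=> x; rewrite /quad_eval /= !mulrNz; ring. Qed.

Hypothesis tQ : quad_model.

Lemma quad_square1 : (square Q).1%:~R = t ^+ 2 - (square Q).2%:~R * t.
Proof. by case: tQ => -> _ _; rewrite addrK. Qed.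

Lemma quad_evalM : {morph quad_eval : x y / quad_mul Q x y >-> x * y}.
Proof.
by move=> x y; rewrite /quad_eval /= !(intrD, intrM) quad_square1; ring.
Qed.

Lemma quad_eq0P x : quad_eq0 Q x -> quad_eval x = 0.
Proof.
case: tQ => _ Q0 _ /andP[/dvdzP[p xp] /dvdzP[q xq]].
by rewrite /quad_eval xp xq !intrM Q0 !mulr0 mul0r addr0.
Qed.

Lemma quad_neq0P x : quad_neq0 Q x -> quad_eval x != 0.
Proof.
case: tQ => _ Q0 nonnullQ /dvdzP[q nonnullE].
have [u [v uv]] := Bezoutz (quad_norm Q x) (null Q).
apply: contraNneq nonnullQ => x0; apply/eqP; rewrite nonnullE -uv.
have norm0 : (quad_norm Q x)%:~R = 0 :> F.
  rewrite !(intrD, intrM, mulrNz) quad_square1.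
  transitivity (quad_eval x * (x.1%:~R + x.2%:~R * ((square Q).2%:~R - t))).
    by rewrite /quad_eval; ring.
  by rewrite x0 mul0r.
by rewrite intrM intrD !intrM norm0 Q0 !mulr0 addr0 mulr0.
Qed.

End QuadraticEvaluation.

Definition quad_rows : Type := seq (seq (int * int)).

Definition quad_entry (d : quad_rows) (i j : nat) : int * int :=
  nth 0 (nth [::] d i) j.

Definition quad_mx (F : fieldType) (t : F) (r n : nat) (d : quad_rows) :
  'M[F]_(r, n) := fun_mx r n (fun i j => quad_eval t (quad_entry d i j)).

Definition quad_minor (Q : quadratic) (r : nat) (d : quad_rows)
    (s : seq nat) : int * int :=
  laplace 0 (1, 0) +%R (quad_mul Q) -%R r
    (fun i k => quad_entry d i (nth 0%N s k)).

Lemma quad_minorE (F : fieldType) (Q : quadratic) (t : F) (r : nat) d s :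
  quad_model Q t ->
  quad_eval t (quad_minor Q r d s) =
  minor r (fun i j => quad_eval t (quad_entry d i j)) s.
Proof.
move=> tQ; apply: laplace_det; rewrite ?quad_eval0 ?quad_eval1 //.
- exact: quad_evalD.
- exact: quad_evalM.
- exact: quad_evalN.
Qed.

Section Comparison.
Variables (r n : nat).
Implicit Types (Q : quadratic) (d : quad_rows) (s : seq nat).

Definition columns : seq (seq nat) := combinations r (iota 0 n).

Definition quad_basis Q d s : bool := quad_neq0 Q (quad_minor Q r d s).

Definition quad_nonbasis Q d s : bool := quad_eq0 Q (quad_minor Q r d s).

(* The test also fails when the status of some minor is not determined.       *)
Definition quad_agree (exempt : pred (seq nat)) Q1 Q2 d1 d2 : bool :=
  all (fun s => [|| exempt s, quad_basis Q1 d1 s && quad_basis Q2 d2 s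
                  | quad_nonbasis Q1 d1 s && quad_nonbasis Q2 d2 s]) columns.

Section OneModel.
Variables (F : fieldType) (Q : quadratic) (t : F) (d : quad_rows).
Hypothesis tQ : quad_model Q t.

Lemma quad_basisP s : s \in columns -> quad_basis Q d s ->
  ord_set n s \in column_indep (quad_mx t r n d).
Proof.
move=> sc /(quad_neq0P tQ).
by rewrite column_indep_minor // (quad_minorE _ _ _ tQ).
Qed.

Lemma quad_nonbasisP s : s \in columns -> quad_nonbasis Q d s ->
  ord_set n s \notin column_indep (quad_mx t r n d).
Proof.
move=> sc /(quad_eq0P tQ) s0.
by rewrite column_indep_minor // -(quad_minorE _ _ _ tQ) s0 eqxx.
Qed.

Lemma quad_basesP s S : s \in columns -> quad_basis Q d s ->
  (S \in bases (column_matroid (quad_mx t r n d))) =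
  (S \in column_indep (quad_mx t r n d)) && (#|S| == r).
Proof.
move=> sc bs; exact: column_basesE (quad_basisP sc bs) (card_ord_set sc).
Qed.

End OneModel.

Section TwoModels.
Variables (F1 F2 : fieldType) (Q1 Q2 : quadratic) (t1 : F1) (t2 : F2).
Hypotheses (tQ1 : quad_model Q1 t1) (tQ2 : quad_model Q2 t2).
Variables d1 d2 : quad_rows.

Let M1 := column_matroid (quad_mx t1 r n d1).
Let M2 := column_matroid (quad_mx t2 r n d2).

Lemma quad_agree_bases exempt s : quad_agree exempt Q1 Q2 d1 d2 ->
  s \in columns -> ~~ exempt s -> quad_basis Q1 d1 s ->
  forall S : {set 'I_n}, (forall u, S = ord_set n u -> ~~ exempt u) ->
  (S \in bases M1) = (S \in bases M2).
Proof.
move=> /allP agree sc nexs bs.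
have indepE u : u \in columns -> ~~ exempt u ->
    (ord_set n u \in indep M1) = (ord_set n u \in indep M2).
  move=> uc /negbTE nexu; have := agree _ uc; rewrite nexu /=.
  case/orP => /andP[].
    by move=> /(quad_basisP tQ1 uc)-> /(quad_basisP tQ2 uc)->.
  by move=> /(quad_nonbasisP tQ1 uc)/negbTE-> /(quad_nonbasisP tQ2 uc)/negbTE->.
have is1 := quad_basisP tQ1 sc bs.
have is2 : ord_set n s \in indep M2 by rewrite -indepE.
move=> S nexS; rewrite (column_basesE _ is1 (card_ord_set sc)).
rewrite (column_basesE _ is2 (card_ord_set sc)).
have [/eqP/combinations_ord_set[u uc Su]|] := boolP (#|S| == r);
  last by rewrite !andbF.
by rewrite !andbT Su indepE // nexS.
Qed.

Definition quad_equal : bool :=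
  quad_agree pred0 Q1 Q2 d1 d2 && has (quad_basis Q1 d1) columns.

Lemma quad_equal_indep : quad_equal -> indep M1 = indep M2.
Proof.
move=> /andP[agree /hasP[s sc bs]]; apply: eq_bases_indep; apply/setP => S.
exact: (quad_agree_bases agree sc).
Qed.

End TwoModels.

(* x.1 is the exceptional set of the matrix x.2. Its elements must not be     *)
(* coloops, nor the other elements loops, for the remaining bases to          *)
(* determine the minors.                                                      *)
Definition quad_relaxation Q1 Q2 d (x : seq nat * quad_rows) : bool :=
  quad_agree (pred1 x.1) Q1 Q2 d x.2 &&
  all (fun e =>
        has (fun s => ((e \in s) == (e \notin x.1)) && quad_basis Q1 d s)
            columns)
      (iota 0 n).

Definition quad_relaxations Q1 Q2 d (L : seq (seq nat * quad_rows)) :=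
  all (quad_relaxation Q1 Q2 d) L &&
  all (fun e => has (fun x => e \in x.1) L && has (fun x => e \notin x.1) L)
      (iota 0 n).

Lemma quad_relaxations_minor (F1 F2 : fieldType) (Q1 Q2 : quadratic)
    (t1 : F1) (t2 : F2) d L (N : matroid 'I_n) :
  quad_model Q1 t1 -> quad_model Q2 t2 -> quad_relaxations Q1 Q2 d L ->
  proper_minor N (column_matroid (quad_mx t1 r n d)) -> representable F2 N.
Proof.
set M := column_matroid _; move=> tQ1 tQ2 /andP[/allP relaxL /allP cover].
move=> [C [D [sC _ dCD /set0Pn[e eCD] ->]]].
have en : (e : nat) \in iota 0 n by rewrite mem_iota /= add0n.
have [[u d'] xL ex] : exists2 x, x \in L &
    e \in (if (e : nat) \in x.1 then D else C).
  have /andP[/hasP[x xL ex] /hasP[y yL ey]] := cover _ en.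
  move: eCD; rewrite inE => /orP[eC|eD].
    by exists y; rewrite ?(negbTE ey).
  by exists x; rewrite ?ex.
have /andP[agree /allP/(_ _ en)/hasP[s sc /andP[/eqP es bs]]] := relaxL _ xL.
have exempt_s : ~~ pred1 u s by apply: contra_eqN es => /eqP->; case: (_ \in u).
pose M' := column_matroid (quad_mx t2 r n d').
have M'CD : representable F2 (delete (contract M' C) D).
  by apply: representable_minor; [exact: subsetT | exact: column_representable].
apply: (@eq_representable _ _ (delete (contract M' C) D)); [by [] | | by []].
apply/esym.
apply: (eq_bases_off_minor_indep (X := ord_set n u) (B := ord_set n s)
  (e := e)) => //.
- move=> S Su; apply: (quad_agree_bases tQ1 tQ2 agree sc exempt_s bs) => v Sv.
  by apply: contra_neqN Su => /eqP /= <-.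
- rewrite (quad_basesP tQ1 _ sc bs) (quad_basisP tQ1 sc bs).
  by rewrite (card_ord_set sc) eqxx.
- by rewrite !inE.
by rewrite inE.
Qed.

Definition image_complement (p s : seq nat) : seq nat :=
  [seq i <- iota 0 n | i \notin [seq nth 0%N p j | j <- s]].

Lemma ord_set_image_complement (p : seq nat) (f : 'I_n -> 'I_n) s :
  (forall i, f i = nth 0%N p i :> nat) -> s \in columns ->
  ord_set n (image_complement p s) = ~: (f @: ord_set n s).
Proof.
move=> fp; rewrite mem_combinations => /andP[/mem_subseq s_iota _].
apply/setP => i; rewrite !inE mem_filter mem_iota /= add0n ltn_ord andbT.
congr (~~ _); apply/mapP/imsetP => [[j js ij]|[j + ->]]; last first.
  by rewrite inE; exists (val j).
have jn : (j < n)%N by have := s_iota _ js; rewrite mem_iota.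
by exists (Ordinal jn); [rewrite inE | apply: val_inj; rewrite /= fp].
Qed.

Definition quad_self_dual Q d (p : seq nat) : bool :=
  [&& perm_eq p (iota 0 n), has (quad_basis Q d) columns &
      all (fun s => let s' := image_complement p s in
             quad_nonbasis Q d s || (s' \in columns) && quad_basis Q d s')
          columns].

Lemma quad_self_dualP (F : fieldType) (Q : quadratic) (t : F) d p :
  quad_model Q t -> quad_self_dual Q d p ->
  let M := column_matroid (quad_mx t r n d) in isomorphic M (dual M).
Proof.
move=> tQ /and3P[pp /hasP[s0 s0c bs0] /allP dualp] M.
have sp : size p = n by rewrite (perm_size pp) size_iota.
have p_lt (i : 'I_n) : (nth 0 p i < n)%N.
  have : nth 0%N p i \in p by rewrite mem_nth ?sp.
  by rewrite (perm_mem pp) mem_iota.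
pose f i := Ordinal (p_lt i).
apply: (@isomorphic_dual _ _ f) => // [i j /(congr1 val)/eqP|B].
  rewrite /= nth_uniq ?sp // => [/eqP/val_inj//|].
  by rewrite (perm_uniq pp) iota_uniq.
rewrite !(quad_basesP tQ _ s0c bs0).
case/andP => iB /eqP/combinations_ord_set[s sc Bs].
have /orP[/(quad_nonbasisP tQ sc)|/andP[s'c bs']] := dualp _ sc.
  by rewrite -Bs iB.
rewrite Bs -(ord_set_image_complement (f := f) (p := p)) //.
by rewrite (quad_basisP tQ s'c bs') (card_ord_set s'c) eqxx.
Qed.

End Comparison.

Section QuadraticNormalForm.
Variables (r n : nat) (d : quad_rows).
Implicit Type s : seq (nat * nat).

Definition unit_entries s : seq (nat * nat) :=
  [seq (i, i) | i <- iota 0 r] ++ s.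

(* The tests are written so that they reduce on concrete indices.             *)
Definition normal_entry (F : fieldType) s (b : nat -> nat -> F) (i j : nat) :=
  if has (fun p => eqn p.1 i && eqn p.2 j) (unit_entries s) then 1
  else if quad_entry d i j is (Posz 0, Posz 0) then 0 else b i j.

Definition quad_normalizable s (Q : quadratic) : bool :=
  [&& (r <= n)%N,
      all2rel (fun i j => quad_entry d i j == ((i == j)%:R, 0)) (iota 0 r),
      forest (unit_entries s) &
      all (fun p => [&& (p.1 < r)%N, (p.2 < n)%N
                      & quad_neq0 Q (quad_entry d p.1 p.2)])
          (unit_entries s)].

Lemma quad_normal_form (F G : fieldType) (Q : quadratic) (t : G) :
  quad_model Q t -> representable F (column_matroid (quad_mx t r n d)) ->
  forall s, quad_normalizable s Q ->
  exists b : nat -> nat -> F, forall u, u \in columns r n ->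
    (quad_nonbasis r Q d u -> minor r (normal_entry s b) u = 0) /\
    (quad_basis r Q d u -> minor r (normal_entry s b) u != 0).
Proof.
move=> tQ + s /and4P[rn /allrelP std fs /allP sd].
pose a i j := quad_eval t (quad_entry d i j).
case/(representable_normal_form rn _ fs (a := a)).
- move=> i j ir jr; rewrite /a (eqP (std i j _ _)) ?mem_iota //.
  by case: (i == j); rewrite ?quad_eval1 ?quad_eval0.
- by move=> p /sd/and3P[-> -> /(quad_neq0P tQ)].
move=> b [bM b0 b1].
have bE : fun_mx r n (normal_entry s b) = fun_mx r n b.
  apply/matrixP => i j; rewrite !mxE /normal_entry.
  case: ifP => [/hasP[p ps]|_].
    by case/andP=> /eqnP pi /eqnP pj; rewrite -(b1 _ ps) pi pj.
  have := b0 i j (ltn_ord i) (ltn_ord j); rewrite /a.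
  case: quad_entry => [[[|?]|?] [[|?]|?]] //.
  by rewrite [quad_eval _ _]quad_eval0 eqxx => /eqP->.
exists b => u uc; rewrite -(column_indep_minor _ uc) bE bM.
split=> [nu|bu]; last exact: (quad_basisP tQ uc bu).
apply/eqP; rewrite -[_ == 0]negbK -(column_indep_minor _ uc) bE bM.
exact: (quad_nonbasisP tQ uc nu).
Qed.

End QuadraticNormalForm.

(** * Characteristics of the representing fields *)

(* There is a model of golden in every characteristic, of eisenstein in every *)
(* characteristic but 3, and of gf4 and gf9 in characteristic 2 and 3 only.   *)
(* The norms of the nonzero minors met over eisenstein all divide 81.         *)
Definition golden := Quadratic (1, 1) 0 1.
Definition gf4 := Quadratic (1, 1) 2 1.
Definition gf9 := Quadratic (1, 1) 3 1.
Definition eisenstein := Quadratic (-1, -1) 0 81.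

Definition V1_rows : quad_rows :=
  [:: [:: (1,0); (0,0); (0,0); (1,0); (0,0); (1,0); (1,0); (1,0); (1,0)];
      [:: (0,0); (1,0); (0,0); (1,0); (1,0); (1,1); (1,1); (0,1); (0,0)];
      [:: (0,0); (0,0); (1,0); (0,0); (1,0); (1,0); (0,1); (1,0); (0,1)]]%Z.

Definition V2_rows : quad_rows :=
  [:: [:: (1,0); (0,0); (0,0); (0,0); (1,0); (1,0); (1,0); (0,0)];
      [:: (0,0); (1,0); (0,0); (0,0); (1,1); (0,1); (0,1); (1,0)];
      [:: (0,0); (0,0); (1,0); (0,0); (0,1); (1,1); (0,1); (1,0)];
      [:: (0,0); (0,0); (0,0); (1,0); (1,1); (1,1); (0,1); (0,1)]]%Z.

Definition V3_rows : quad_rows :=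
  [:: [:: (1,0); (0,0); (0,0); (0,0); (1,0); (0,0); (1,0); (1,0); (1,0)];
      [:: (0,0); (1,0); (0,0); (0,0); (0,1); (1,0); (1,1); (1,1); (1,0)];
      [:: (0,0); (0,0); (1,0); (0,0); (0,1); (1,0); (0,1); (1,0); (1,1)];
      [:: (0,0); (0,0); (0,0); (1,0); (0,0); (1,0); (1,0); (0,0); (0,0)]]%Z.

Definition P1_rows : quad_rows :=
  [:: [:: (0,0); (1,0); (1,0); (1,0); (1,0); (1,0); (0,0); (0,0); (0,0)];
      [:: (0,0); (1,0); (0,1); (0,0); (0,0); (0,0); (1,0); (1,0); (1,0)];
      [:: (1,0); (0,0); (0,0); (1,0); (0,1); (1,1); (1,0); (0,1); (1,1)]]%Z.

Definition P2_rows : quad_rows :=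
  [:: [:: (1,0); (0,0); (0,0); (0,0); (1,0); (0,0); (1,0); (1,0)];
      [:: (0,0); (1,0); (0,0); (0,0); (0,1); (1,0); (1,0); (1,0)];
      [:: (0,0); (0,0); (1,0); (0,0); (1,0); (1,0); (0,0); (1,0)];
      [:: (0,0); (0,0); (0,0); (1,0); (1,1); (1,0); (1,1); (0,0)]]%Z.

Definition P3_rows : quad_rows :=
  [:: [:: (0,0); (1,0); (1,0); (1,0); (1,0); (1,0); (1,0); (0,0); (0,0)];
      [:: (0,0); (1,0); (0,1); (1,1); (0,0); (0,0); (0,0); (1,0); (1,0)];
      [:: (1,0); (0,0); (0,0); (0,0); (1,0); (0,1); (1,1); (1,0); (0,1)]]%Z.

(* Representations [I | D] of P1, P2 and P3, with t a primitive cube root of  *)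
(* unity.                                                                     *)
Definition P1_eisenstein : quad_rows :=
  [:: [:: (1,0); (0,0); (0,0); (1,0); (1,0); (1,0); (1,0); (1,0); (1,0)];
      [:: (0,0); (1,0); (0,0); (1,0); (0,1); (-1,-1); (0,1); (-1,-1); (1,0)];
      [:: (0,0); (0,0); (1,0); (1,0); (0,1); (-1,-1); (1,0); (0,1); (-1,-1)]]%Z.

Definition P2_eisenstein : quad_rows :=
  [:: [:: (1,0); (0,0); (0,0); (0,0); (1,0); (0,0); (1,-1); (1,-1)];
      [:: (0,0); (1,0); (0,0); (0,0); (1,0); (1,0); (1,0); (1,0)];
      [:: (0,0); (0,0); (1,0); (0,0); (1,0); (1,-1); (0,0); (1,-1)];
      [:: (0,0); (0,0); (0,0); (1,0); (1,0); (2,1); (1,-1); (0,0)]]%Z.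

Definition P3_eisenstein : quad_rows :=
  [:: [:: (1,0); (0,0); (0,0); (0,0); (1,0); (1,0); (1,0); (1,0); (1,0)];
      [:: (0,0); (1,0); (0,0); (1,0); (1,0); (-1,-1); (0,1); (-1,-1); (0,1)];
      [:: (0,0); (0,0); (1,0); (1,0); (0,-1); (-1,0); (1,1); (0,-1); (-1,0)]]%Z.

Local Notation "b @[ i , j ]" := (b i%N j%N)
  (at level 8, format "b @[ i ,  j ]").

Lemma eq_of_sub_eq_or_opp (F : fieldType) (x y z : F) :
  z = 0 -> x - y = z \/ x - y = - z -> x = y.
Proof. by move=> -> []; rewrite ?oppr0; apply: subr0_eq. Qed.

Lemma neq0_of_eq_or_opp (F : fieldType) (x z : F) :
  z != 0 -> x = z \/ x = - z -> x != 0.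
Proof. by move=> z0 [] ->; rewrite ?oppr_eq0. Qed.

Ltac expand_minor E :=
  rewrite minor_laplace /normal_entry /= ?E;
  first [by left; ring | by right; ring].

(* Proves x = y when x - y is, up to sign, the minor of the nonbasis s in     *)
(* which the entries are rewritten with E.                                    *)
Tactic Notation "by_nonbasis" constr(bP) constr(s) "using" constr(E) :=
  apply: (eq_of_sub_eq_or_opp ((bP s isT).1 isT)); expand_minor E.

Tactic Notation "by_nonbasis" constr(bP) constr(s) := by_nonbasis bP s using tt.

Tactic Notation "by_basis" constr(bP) constr(s) "using" constr(E) :=
  apply: (neq0_of_eq_or_opp ((bP s isT).2 isT)); expand_minor E.

Tactic Notation "by_basis" constr(bP) constr(s) := by_basis bP s using tt.

Section Characteristic.
Variables (F G : fieldType) (t : G).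

Lemma V1_representable_two_eq0 : quad_model gf4 t ->
  representable F (column_matroid (quad_mx t 3 9 V1_rows)) -> 2%:R = 0 :> F.
Proof.
move=> tQ /(quad_normal_form tQ)/(_
  [:: (0,5); (0,6); (0,7); (0,8); (2,4); (1,4); (1,3); (0,3)]%N isT)[b bP].
have b16_neq0 : b@[1, 6] != 0 by by_basis bP [:: 0; 2; 6]%N.
have b15 : b@[1, 5] = b@[1, 6] by by_nonbasis bP [:: 2; 5; 6]%N.
have b26 : b@[2, 6] = b@[1, 6] - 1 by by_nonbasis bP [:: 3; 4; 6]%N.
have b28 : b@[2, 8] = b@[1, 6] - 1 by by_nonbasis bP [:: 1; 6; 8]%N using b26.
have b25 : b@[2, 5] = 2%:R * b@[1, 6] - 1.
  by by_nonbasis bP [:: 4; 5; 8]%N using (b15, b28).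
have b27 : b@[2, 7] = b@[2, 5] by by_nonbasis bP [:: 1; 5; 7]%N.
have m067 : b@[1, 6] * b@[2, 7] = b@[1, 7] * b@[2, 6].
  by by_nonbasis bP [:: 0; 6; 7]%N.
have m378 : b@[1, 7] * b@[2, 8] = b@[2, 8] - b@[2, 7].
  by by_nonbasis bP [:: 3; 7; 8]%N.
apply: (mulIf (expf_neq0 2 b16_neq0)); rewrite mul0r.
transitivity (b@[1, 6] * b@[2, 7] - (b@[2, 8] - b@[2, 7])).
  by rewrite b27 b25 b28; ring.
by rewrite m067 -m378 b26 b28 subrr.
Qed.

Lemma V2_representable_two_eq0 : quad_model gf4 t ->
  representable F (column_matroid (quad_mx t 4 8 V2_rows)) -> 2%:R = 0 :> F.
Proof.
move=> tQ /(quad_normal_form tQ)/(_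
  [:: (0,5); (0,6); (1,7); (1,4); (2,4); (3,4); (0,4)]%N isT)[b bP].
have b27_neq1 : b@[2, 7] - 1 != 0 by by_basis bP [:: 0; 3; 4; 7]%N.
have b37 : b@[3, 7] = b@[2, 7] by by_nonbasis bP [:: 0; 1; 4; 7]%N.
have b16 : b@[1, 6] = b@[1, 5] by by_nonbasis bP [:: 2; 3; 5; 6]%N.
have b36 : b@[3, 6] = b@[1, 5].
  by rewrite -b16; by_nonbasis bP [:: 0; 2; 4; 6]%N.
have b35 : b@[3, 5] = 1 by by_nonbasis bP [:: 1; 2; 4; 5]%N.
have b26 : b@[2, 6] = 1 by by_nonbasis bP [:: 1; 3; 4; 6]%N.
have b15b27 : b@[1, 5] * b@[2, 7] = 1.
  by by_nonbasis bP [:: 0; 2; 5; 7]%N using (b37, b35).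
have b25b15 : b@[2, 5] * b@[1, 5] = 1.
  by by_nonbasis bP [:: 0; 1; 5; 6]%N using (b36, b35, b26).
have b25 : b@[2, 5] = b@[2, 7].
  by rewrite -[LHS]mulr1 -b15b27 mulrA b25b15 mul1r.
have m3457 : b@[1, 5] * b@[2, 7] = b@[2, 5] + b@[2, 7] - 1.
  by by_nonbasis bP [:: 3; 4; 5; 7]%N.
apply: (mulIf b27_neq1); rewrite mul0r.
transitivity (b@[2, 5] + b@[2, 7] - 1 - 1); first by rewrite b25; ring.
by rewrite -m3457 b15b27 subrr.
Qed.

Lemma V3_representable_two_eq0 : quad_model gf4 t ->
  representable F (column_matroid (quad_mx t 4 9 V3_rows)) -> 2%:R = 0 :> F.
Proof.
move=> tQ /(quad_normal_form tQ)/(_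
  [:: (0,6); (0,7); (0,8); (2,5); (3,5); (1,5); (1,4); (0,4)]%N isT)[b bP].
have b36_neq0 : b@[3, 6] != 0 by by_basis bP [:: 0; 1; 2; 6]%N.
have b24 : b@[2, 4] = 1 by by_nonbasis bP [:: 0; 3; 4; 5]%N.
have b26 : b@[2, 6] = 1 by by_nonbasis bP [:: 1; 3; 4; 6]%N using b24.
have b16 : b@[1, 6] = b@[3, 6] + 1.
  by by_nonbasis bP [:: 2; 4; 5; 6]%N.
have b17 : b@[1, 7] = b@[3, 6] + 1.
  by by_nonbasis bP [:: 2; 3; 6; 7]%N using b16.
have b28 : b@[2, 8] = 1 - b@[3, 6].
  by by_nonbasis bP [:: 1; 5; 6; 8]%N using b26.
have b18 : b@[1, 8] = (b@[3, 6] + 1) * (1 - b@[3, 6]).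
  by by_nonbasis bP [:: 0; 3; 6; 8]%N using (b16, b26, b28).
have b27 : b@[2, 7] = 1 + b@[3, 6] ^+ 2.
  by by_nonbasis bP [:: 3; 5; 7; 8]%N using (b17, b18, b28).
apply: (mulIf (expf_neq0 2 b36_neq0)); rewrite mul0r.
by by_nonbasis bP [:: 0; 5; 6; 7]%N using (b16, b17, b26, b27).
Qed.

Lemma cube_root_three_neq0 (w : F) : w ^+ 3 = 1 -> w - 1 != 0 -> 3%:R != 0 :> F.
Proof.
move=> w3; apply: contra_neq => three.
have /eqP : (w - 1) ^+ 3 = 0; last by rewrite expf_eq0 => /eqP.
transitivity (w ^+ 3 - 1 - 3%:R * (w * (w - 1))); first by ring.
by rewrite w3 three mul0r subr0 subrr.
Qed.

Lemma P1_representable_three_neq0 : quad_model eisenstein t ->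
  representable F (column_matroid (quad_mx t 3 9 P1_eisenstein)) ->
  3%:R != 0 :> F.
Proof.
move=> tQ /(quad_normal_form tQ)/(_
  [:: (0,4); (0,5); (0,6); (0,7); (0,8); (1,3); (2,3); (0,3)]%N isT)[b bP].
have b25 : b@[2, 5] = b@[1, 5] by by_nonbasis bP [:: 0; 3; 5]%N.
have b15_neq1 : b@[1, 5] - 1 != 0 by by_basis bP [:: 1; 3; 5]%N using b25.
have b26 : b@[2, 6] = 1 by by_nonbasis bP [:: 1; 3; 6]%N.
have b18 : b@[1, 8] = 1 by by_nonbasis bP [:: 2; 3; 8]%N.
have b28 : b@[2, 8] = b@[1, 5] by by_nonbasis bP [:: 1; 5; 8]%N using b25.
have b17 : b@[1, 7] = b@[1, 5] by by_nonbasis bP [:: 2; 5; 7]%N.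
have b24 : b@[2, 4] = b@[1, 4] by by_nonbasis bP [:: 0; 3; 4]%N.
have b27 : b@[2, 7] = b@[1, 4] by by_nonbasis bP [:: 1; 4; 7]%N using b24.
have b16 : b@[1, 6] = b@[1, 4] by by_nonbasis bP [:: 2; 4; 6]%N.
have b14 : b@[1, 4] = b@[1, 5] ^+ 2.
  by by_nonbasis bP [:: 0; 7; 8]%N using (b17, b18, b27, b28).
apply: cube_root_three_neq0 b15_neq1.
by by_nonbasis bP [:: 0; 6; 8]%N using (b16, b18, b26, b28, b14).
Qed.

Lemma P2_representable_three_neq0 : quad_model eisenstein t ->
  representable F (column_matroid (quad_mx t 4 8 P2_eisenstein)) ->
  3%:R != 0 :> F.
Proof.
move=> tQ /(quad_normal_form tQ)/(_
  [:: (0,6); (0,7); (1,5); (1,4); (2,4); (3,4); (0,4)]%N isT)[b bP].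
have b25_neq0 : b@[2, 5] != 0 by by_basis bP [:: 0; 1; 3; 5]%N.
have b36 : b@[3, 6] = 1 by by_nonbasis bP [:: 1; 2; 4; 6]%N.
have b27 : b@[2, 7] = 1 by by_nonbasis bP [:: 1; 3; 4; 7]%N.
have b17 : b@[1, 7] = b@[1, 6] by by_nonbasis bP [:: 2; 3; 6; 7]%N.
have b25b16 : b@[2, 5] * b@[1, 6] = 1.
  by by_nonbasis bP [:: 0; 3; 5; 7]%N using (b17, b27).
have b35b16 : b@[3, 5] * b@[1, 6] = b@[3, 5] - 1.
  by by_nonbasis bP [:: 2; 4; 5; 7]%N using b17.
have b25 : b@[2, 5] = 3%:R - b@[3, 5].
  transitivity (1 + b@[2, 5] * b@[1, 6] - b@[3, 5] * b@[1, 6]).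
    by by_nonbasis bP [:: 0; 4; 5; 6]%N using b36.
  by rewrite b25b16 b35b16; ring.
apply: contra_neq b25_neq0 => three.
have b35 : b@[3, 5] = - b@[2, 5] by rewrite b25 three sub0r opprK.
apply: (eq_of_sub_eq_or_opp (z := b@[3, 5] - 1 - b@[3, 5] * b@[1, 6])).
  by rewrite b35b16 subrr.
by right; rewrite b35 mulNr b25b16; ring.
Qed.

Lemma P3_representable_three_neq0 : quad_model eisenstein t ->
  representable F (column_matroid (quad_mx t 3 9 P3_eisenstein)) ->
  3%:R != 0 :> F.
Proof.
move=> tQ /(quad_normal_form tQ)/(_
  [:: (0,5); (0,6); (0,7); (0,8); (2,3); (1,3); (1,4); (0,4)]%N isT)[b bP].
have b24_neq0 : b@[2, 4] != 0 by by_basis bP [:: 0; 1; 4]%N.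
have b15_neq1 : b@[1, 5] - 1 != 0 by by_basis bP [:: 2; 4; 5]%N.
have b25 : b@[2, 5] = b@[2, 4] * b@[1, 5] by by_nonbasis bP [:: 0; 4; 5]%N.
have b26 : b@[2, 6] = b@[2, 4] * b@[1, 6] by by_nonbasis bP [:: 0; 4; 6]%N.
have b27 : b@[2, 7] = b@[2, 4] by by_nonbasis bP [:: 1; 4; 7]%N.
have b17 : b@[1, 7] = b@[1, 5] by by_nonbasis bP [:: 2; 5; 7]%N.
have b18 : b@[1, 8] = b@[1, 6] by by_nonbasis bP [:: 2; 6; 8]%N.
have b28 : b@[2, 8] = b@[2, 4] * b@[1, 5].
  by by_nonbasis bP [:: 1; 5; 8]%N using b25.
have b16 : b@[1, 6] = b@[1, 5] ^+ 2.
  apply: (mulfI b24_neq0).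
  by by_nonbasis bP [:: 0; 7; 8]%N using (b17, b18, b27, b28).
have b24 : b@[2, 4] = b@[1, 5] + 1.
  apply: (mulIf b15_neq1).
  by by_nonbasis bP [:: 3; 4; 8]%N using (b18, b28, b16).
apply: cube_root_three_neq0 b15_neq1.
by by_nonbasis bP [:: 3; 6; 7]%N using (b17, b26, b27, b24, b16).
Qed.

End Characteristic.

(** * Relaxations *)

Definition V1_relaxations : seq (seq nat * quad_rows) :=
[:: ([:: 0; 2; 8]%N,
  [:: [:: (1,0); (1,0); (0,0); (0,0); (1,0); (1,0); (1,0); (1,0); (1,0)];
      [:: (0,0); (0,0); (1,0); (0,0); (1,0); (1,1); (1,0); (0,-1); (0,-1)];
      [:: (2,-1); (0,0); (0,0); (1,0); (0,0); (1,0); (1,0); (1,-1); (0,-1)]]%Z);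
    ([:: 1; 5; 7]%N,
  [:: [:: (1,0); (1,0); (0,0); (0,0); (1,0); (1,0); (1,0); (1,0); (1,0)];
      [:: (0,0); (0,0); (1,0); (0,0); (1,0); (0,1); (1,0); (1,1); (1,1)];
      [:: (0,0); (1,0); (0,0); (1,0); (1,0); (-1,1); (-1,1); (0,1); (0,0)]]%Z);
    ([:: 3; 4; 6]%N,
  [:: [:: (1,0); (0,0); (0,0); (1,0); (0,0); (1,0); (1,0); (1,0); (1,0)];
      [:: (0,0); (1,0); (0,0); (0,-1); (1,0); (1,0); (1,0); (1,1); (0,0)];
      [:: (0,0); (0,0); (1,0); (0,0); (1,0); (0,1); (-1,1); (0,1); (-1,1)]]%Z)].

Definition V2_relaxations : seq (seq nat * quad_rows) :=
[:: ([:: 0; 1; 5; 6]%N,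
  [:: [:: (1,0); (1,0); (0,0); (0,0); (0,0); (1,0); (1,0); (1,0)];
      [:: (-1,1); (0,0); (1,0); (0,0); (0,0); (1,0); (0,0); (1,0)];
      [:: (1,0); (0,0); (0,0); (1,0); (0,0); (0,0); (1,0); (0,1)];
      [:: (2,-1); (0,0); (0,0); (0,0); (1,0); (1,0); (1,0); (0,0)]]%Z);
    ([:: 3; 4; 5; 7]%N,
  [:: [:: (1,0); (0,0); (0,0); (1,0); (0,0); (0,0); (1,0); (1,0)];
      [:: (0,0); (1,0); (0,0); (-1,1); (0,0); (1,0); (0,0); (0,1)];
      [:: (0,0); (0,0); (1,0); (1,0); (0,0); (1,0); (1,0); (0,0)];
      [:: (0,0); (0,0); (0,0); (0,1); (1,0); (1,0); (1,0); (0,1)]]%Z);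
    ([:: 0; 2; 4; 6]%N,
  [:: [:: (1,0); (0,0); (1,0); (0,0); (0,0); (1,0); (0,0); (1,0)];
      [:: (0,0); (1,0); (0,1); (0,0); (0,0); (1,0); (1,0); (1,0)];
      [:: (0,0); (0,0); (1,0); (1,0); (0,0); (1,0); (1,1); (0,0)];
      [:: (0,0); (0,0); (1,1); (0,0); (1,0); (1,0); (1,1); (1,1)]]%Z)].

Definition V3_relaxations : seq (seq nat * quad_rows) :=
[:: ([:: 0; 3; 4; 5]%N,
  [:: [:: (1,0); (1,0); (0,0); (0,0); (0,0); (1,0); (1,0); (1,0); (1,0)];
      [:: (-1,0); (0,0); (1,0); (0,0); (0,0); (1,0); (0,0); (-1,1); (0,1)];
      [:: (0,0); (0,0); (0,0); (1,0); (0,0); (1,0); (1,0); (0,0); (0,0)];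
      [:: (1,1); (0,0); (0,0); (0,0); (1,0); (0,0); (1,0); (1,0); (0,-1)]]%Z);
    ([:: 1; 5; 6; 8]%N,
  [:: [:: (1,0); (0,0); (0,0); (0,0); (1,0); (0,0); (1,0); (1,0); (1,0)];
      [:: (0,0); (1,0); (0,0); (0,0); (1,0); (1,0); (0,1); (0,1); (1,1)];
      [:: (0,0); (0,0); (1,0); (0,0); (1,0); (1,0); (1,0); (-1,1); (0,1)];
      [:: (0,0); (0,0); (0,0); (1,0); (0,0); (0,1); (1,0); (0,0); (0,0)]]%Z);
    ([:: 2; 3; 6; 7]%N,
  [:: [:: (1,0); (0,0); (0,0); (0,0); (1,0); (0,0); (1,0); (1,0); (1,0)];
      [:: (0,0); (1,0); (0,0); (1,0); (1,0); (0,0); (1,0); (0,1); (-1,1)];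
      [:: (0,0); (0,0); (1,0); (1,0); (1,0); (0,0); (0,1); (1,1); (0,1)];
      [:: (0,0); (0,0); (0,0); (0,1); (0,0); (1,0); (1,0); (0,0); (0,0)]]%Z)].

Definition P1_relaxations : seq (seq nat * quad_rows) :=
[:: ([:: 0; 1; 2]%N,
  [:: [:: (1,0); (0,0); (1,0); (0,0); (1,0); (1,0); (0,0); (1,0); (1,0)];
      [:: (0,0); (1,0); (1,0); (0,0); (0,0); (0,0); (1,0); (2,0); (1,0)];
      [:: (0,0); (0,0); (0,0); (1,0); (1,0); (2,0); (2,0); (1,0); (2,0)]]%Z);
    ([:: 1; 3; 6]%N,
  [:: [:: (1,0); (0,0); (0,0); (1,0); (1,0); (1,0); (1,0); (1,0); (1,0)];
      [:: (0,0); (1,0); (0,0); (1,0); (1,1); (0,1); (1,1); (0,1); (1,0)];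
      [:: (0,0); (0,0); (1,0); (1,0); (1,1); (0,1); (1,2); (1,1); (0,1)]]%Z);
    ([:: 1; 4; 7]%N,
  [:: [:: (1,0); (0,0); (0,0); (1,0); (1,0); (1,0); (1,0); (1,0); (1,0)];
      [:: (0,0); (1,0); (0,0); (1,0); (2,1); (0,1); (2,1); (0,1); (1,0)];
      [:: (0,0); (0,0); (1,0); (1,0); (2,1); (0,1); (1,0); (1,1); (0,1)]]%Z);
    ([:: 1; 5; 8]%N,
  [:: [:: (1,0); (0,0); (0,0); (1,0); (1,0); (1,0); (1,0); (1,0); (1,0)];
      [:: (0,0); (1,0); (0,0); (1,0); (0,1); (1,1); (0,1); (1,1); (1,0)];
      [:: (0,0); (0,0); (1,0); (1,0); (0,1); (1,1); (1,0); (0,1); (2,1)]]%Z);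
    ([:: 2; 3; 8]%N,
  [:: [:: (1,0); (0,0); (0,0); (1,0); (1,0); (1,0); (1,0); (1,0); (1,0)];
      [:: (0,0); (1,0); (0,0); (1,0); (0,1); (1,1); (0,1); (1,1); (1,2)];
      [:: (0,0); (0,0); (1,0); (1,0); (0,1); (1,1); (1,0); (0,1); (1,1)]]%Z)].

Definition P2_relaxations : seq (seq nat * quad_rows) :=
[:: ([:: 0; 1; 3; 6]%N,
  [:: [:: (1,0); (0,0); (0,0); (0,0); (1,0); (0,0); (1,0); (1,0)];
      [:: (0,0); (1,0); (0,0); (0,0); (1,0); (1,0); (2,1); (2,1)];
      [:: (0,0); (0,0); (1,0); (0,0); (1,0); (0,1); (1,1); (1,0)];
      [:: (0,0); (0,0); (0,0); (1,0); (1,0); (1,1); (1,0); (0,0)]]%Z);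
    ([:: 2; 4; 5; 7]%N,
  [:: [:: (1,0); (0,0); (0,0); (0,0); (1,0); (0,0); (1,0); (1,0)];
      [:: (0,0); (1,0); (0,0); (0,0); (1,0); (1,0); (0,1); (0,1)];
      [:: (0,0); (0,0); (1,0); (0,0); (1,0); (2,1); (0,0); (1,0)];
      [:: (0,0); (0,0); (0,0); (1,0); (1,0); (2,0); (1,0); (0,0)]]%Z)].

Definition P3_relaxations : seq (seq nat * quad_rows) :=
[:: ([:: 0; 7; 8]%N,
  [:: [:: (1,0); (0,0); (0,0); (0,0); (1,0); (1,0); (1,0); (1,0); (1,0)];
      [:: (0,0); (1,0); (0,0); (1,0); (1,0); (0,2); (2,1); (0,2); (2,1)];
      [:: (0,0); (0,0); (1,0); (1,0); (2,0); (0,1); (1,2); (2,0); (0,1)]]%Z);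
    ([:: 1; 2; 3]%N,
  [:: [:: (1,0); (0,0); (0,0); (1,0); (1,0); (1,0); (1,0); (1,0); (1,0)];
      [:: (0,0); (1,0); (0,0); (1,0); (2,0); (0,1); (2,2); (0,1); (2,2)];
      [:: (0,0); (0,0); (1,0); (1,0); (0,2); (1,1); (2,1); (0,2); (1,1)]]%Z);
    ([:: 1; 4; 7]%N,
  [:: [:: (1,0); (0,0); (0,0); (0,0); (1,0); (1,0); (1,0); (1,0); (1,0)];
      [:: (0,0); (1,0); (0,0); (1,0); (1,0); (1,1); (0,1); (1,1); (0,1)];
      [:: (0,0); (0,0); (1,0); (1,0); (2,2); (1,0); (2,1); (0,1); (1,0)]]%Z);
    ([:: 1; 5; 8]%N,
  [:: [:: (1,0); (0,0); (0,0); (0,0); (1,0); (1,0); (1,0); (1,0); (1,0)];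
      [:: (0,0); (1,0); (0,0); (1,0); (1,0); (1,1); (0,2); (1,1); (0,2)];
      [:: (0,0); (0,0); (1,0); (1,0); (0,1); (1,2); (2,2); (0,1); (2,0)]]%Z);
    ([:: 2; 6; 8]%N,
  [:: [:: (1,0); (0,0); (0,0); (0,0); (1,0); (1,0); (1,0); (1,0); (1,0)];
      [:: (0,0); (1,0); (0,0); (1,0); (1,0); (2,1); (0,1); (2,1); (2,2)];
      [:: (0,0); (0,0); (1,0); (1,0); (0,1); (1,0); (1,1); (0,1); (1,0)]]%Z)].

Lemma V1_relaxationsP : quad_relaxations 3 9 gf4 golden V1_rows V1_relaxations.
Proof. by vm_compute. Qed.

Lemma V2_relaxationsP : quad_relaxations 4 8 gf4 golden V2_rows V2_relaxations.
Proof. by vm_compute. Qed.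

Lemma V3_relaxationsP : quad_relaxations 4 9 gf4 golden V3_rows V3_relaxations.
Proof. by vm_compute. Qed.

Lemma P1_relaxationsP : quad_relaxations 3 9 gf4 gf9 P1_rows P1_relaxations.
Proof. by vm_compute. Qed.

Lemma P2_relaxationsP : quad_relaxations 4 8 gf4 gf9 P2_rows P2_relaxations.
Proof. by vm_compute. Qed.

Lemma P3_relaxationsP : quad_relaxations 3 9 gf4 gf9 P3_rows P3_relaxations.
Proof. by vm_compute. Qed.

Lemma P1_eisensteinP : quad_equal 3 9 gf4 eisenstein P1_rows P1_eisenstein.
Proof. by vm_compute. Qed.

Lemma P2_eisensteinP : quad_equal 4 8 gf4 eisenstein P2_rows P2_eisenstein.
Proof. by vm_compute. Qed.

Lemma P3_eisensteinP : quad_equal 3 9 gf4 eisenstein P3_rows P3_eisenstein.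
Proof. by vm_compute. Qed.

Lemma V2_self_dual : quad_self_dual 4 8 gf4 V2_rows [:: 0; 1; 5; 3; 4; 2; 6; 7].
Proof. by vm_compute. Qed.

Lemma P2_self_dual : quad_self_dual 4 8 gf4 P2_rows [:: 1; 0; 5; 6; 7; 2; 3; 4].
Proof. by vm_compute. Qed.

(** * Characteristic sets and excluded minors *)

Lemma has_char_prime (F : fieldType) (k : nat) :
  has_char F k -> prime k \/ k = 0%N.
Proof.
by rewrite /has_char; case: eqP => [-> _|_ /pcharf_prime]; [right | left].
Qed.

Lemma has_char_intr_eq0 (F : fieldType) (k : nat) (z : int) : has_char F k ->
  (z%:~R == 0 :> F) = (k %| z)%Z.
Proof.
move=> Fk; have natr m : (m%:R == 0 :> F) = (k %| m)%N.
  move: Fk; rewrite /has_char; case: eqP => [-> /pcharf0P->|_ /dvdn_pcharf->//].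
  by rewrite dvd0n.
case: z => m; rewrite dvdzE ?NegzE ?mulrNz ?oppr_eq0 ?abszN; exact: natr.
Qed.

Lemma quad_model_of_char (Q : quadratic) (k : nat) : prime k \/ k = 0%N ->
  (k %| null Q)%Z -> ~~ (k %| nonnull Q)%Z ->
  exists (K : fieldType) (t : K), has_char K k /\ quad_model Q t.
Proof.
move=> kP kQ0 kQ1.
have [F Fk] : exists F : countFieldType, has_char F k.
  case: kP => [pk | ->].
    by exists 'F_k; rewrite /has_char eqn0Ngt prime_gt0 //=; exact: pchar_Fp.
  by exists rat; apply: Num.Theory.pchar_num.
have [K [f _]] := countable_algebraic_closure F.
have Kk : has_char K k.
  move: Fk; rewrite /has_char; case: eqP => _ Fk.
    by move=> p; rewrite (fmorph_pchar f).
  by rewrite (fmorph_pchar f).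
have [t tE] := @solve_monicpoly K 2
  (fun i => [:: (square Q).1%:~R; (square Q).2%:~R]`_i) isT.
exists K, t; split=> //; split; last by rewrite (has_char_intr_eq0 _ Kk).
  by rewrite tE !big_ord_recl big_ord0 /= expr0 expr1 mulr1 addr0.
by apply/eqP; rewrite (has_char_intr_eq0 _ Kk).
Qed.

Section ExcludedMinors.
Variables (GF4 : finFieldType) (card_GF4 : #|GF4| = 4%N).
Variables (alpha : GF4) (alphaE : alpha ^+ 2 = alpha + 1).

Lemma has_char_GF4 : has_char GF4 2.
Proof. exact: (@card_finPcharP _ 2 2). Qed.

Lemma quad_model_GF4 (Q : quadratic) :
  ((2 %| (square Q).1 - 1) && (2 %| (square Q).2 - 1))%Z ->
  (2 %| null Q)%Z -> ~~ (2 %| nonnull Q)%Z -> quad_model Q alpha.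
Proof.
rewrite -!(has_char_intr_eq0 _ has_char_GF4) !intrB !subr_eq0.
move=> /andP[/eqP sq1 /eqP sq2] /eqP Q0 Q1; split=> //.
by rewrite alphaE /quad_eval sq1 sq2 mul1r addrC.
Qed.

Lemma mx_of_rows_quad (r n : nat) (d : quad_rows) :
  mx_of_rows r n (map (map (quad_eval alpha)) d) = quad_mx alpha r n d.
Proof.
apply/matrixP => i j; rewrite !mxE /quad_entry.
have [id|di] := ltnP i (size d); last first.
  by rewrite !(nth_default [::]) ?size_map // !nth_nil quad_eval0.
rewrite (nth_map [::]) //; have [jd|dj] := ltnP j (size (nth [::] d i)).
  by rewrite (nth_map 0).
by rewrite [RHS](f_equal _ (nth_default _ dj)) quad_eval0 nth_default ?size_map.
Qed.

Lemma quad_eval_GF4 :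
  ((quad_eval alpha (0, 0) = 0) * (quad_eval alpha (1, 0) = 1) *
   (quad_eval alpha (0, 1) = alpha) *
   (quad_eval alpha (1, 1) = alpha ^+ 2))%type.
Proof.
rewrite [quad_eval _ (0, 0)]quad_eval0 quad_eval1 /quad_eval !mul1r add0r.
by rewrite alphaE addrC.
Qed.

Lemma V1_quad : V1 alpha = column_matroid (quad_mx alpha 3 9 V1_rows).
Proof. by rewrite -mx_of_rows_quad /= !quad_eval_GF4. Qed.

Lemma V2_quad : V2 alpha = column_matroid (quad_mx alpha 4 8 V2_rows).
Proof. by rewrite -mx_of_rows_quad /= !quad_eval_GF4. Qed.

Lemma V3_quad : V3 alpha = column_matroid (quad_mx alpha 4 9 V3_rows).
Proof. by rewrite -mx_of_rows_quad /= !quad_eval_GF4. Qed.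

Lemma P1_quad : P1 alpha = column_matroid (quad_mx alpha 3 9 P1_rows).
Proof. by rewrite -mx_of_rows_quad /= !quad_eval_GF4. Qed.

Lemma P2_quad : P2 alpha = column_matroid (quad_mx alpha 4 8 P2_rows).
Proof. by rewrite -mx_of_rows_quad /= !quad_eval_GF4. Qed.

Lemma P3_quad : P3 alpha = column_matroid (quad_mx alpha 3 9 P3_rows).
Proof. by rewrite -mx_of_rows_quad /= !quad_eval_GF4. Qed.

Lemma gf4_model : quad_model gf4 alpha.
Proof. exact: quad_model_GF4. Qed.

Lemma eisenstein_model : quad_model eisenstein alpha.
Proof. exact: quad_model_GF4. Qed.

Variables (r n : nat) (d : quad_rows).
Let M := column_matroid (quad_mx alpha r n d).

Lemma proper_minor_GF4 N : proper_minor N M -> representable GF4 N.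
Proof.
move=> [C [D [sC _ _ _ ->]]]; apply: representable_minor sC _.
exact: column_representable.
Qed.

Section CharacteristicTwo.
Hypothesis two_eq0 : forall F : fieldType, representable F M -> 2%:R = 0 :> F.

Lemma char_set_eq2 k : char_set M k <-> k = 2.
Proof.
split=> [[F Fk /two_eq0/eqP F2]|->]; last first.
  by exists GF4; [exact: has_char_GF4 | exact: column_representable].
have := has_char_intr_eq0 2%:Z Fk; rewrite F2 => /esym k2.
have [pk|k0] := has_char_prime Fk; last by move: k2; rewrite k0.
by apply/eqP; rewrite -dvdn_prime2.
Qed.

Lemma excluded_minor_eq2 L :
  quad_relaxations r n gf4 golden d L -> excluded_minor (all_char GF4) M.
Proof.
move=> relaxL; split=> [[_ /(_ 0%N (or_intror erefl))/char_set_eq2]|N NM] //.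
split=> [|k kP]; first exact: proper_minor_GF4.
have [|||K [t [Kk tQ]]] := @quad_model_of_char golden k => //.
  by case: kP => [pk|->] //; rewrite dvdz1 /=; case: k pk => [|[]].
exists K => //; exact: quad_relaxations_minor gf4_model tQ relaxL NM.
Qed.

End CharacteristicTwo.

Section CharacteristicThree.
Variable d' : quad_rows.
Hypothesis dE : quad_equal r n gf4 eisenstein d d'.
Let M' (K : fieldType) (t : K) := column_matroid (quad_mx t r n d').
Hypothesis three_neq0 :
  forall F : fieldType, representable F (M' alpha) -> 3%:R != 0 :> F.

Let indepM' (K : fieldType) (t : K) :
  quad_model eisenstein t -> indep M = indep (M' t).
Proof. move=> tQ; exact: (quad_equal_indep gf4_model tQ dE). Qed.

Lemma representable_neq3 k : (prime k /\ k <> 3) \/ k = 0%N ->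
  exists2 K : fieldType, has_char K k & representable K M.
Proof.
move=> kP; have [|||K [t [Kk tQ]]] := @quad_model_of_char eisenstein k => //.
- by case: kP => [[]|]; [left | right].
- case: kP => [[pk /eqP]|->] //.
  rewrite dvdzE -[absz (nonnull _)]/(3 ^ 4)%N Euclid_dvdX //.
  by rewrite dvdn_prime2 ?andbT.
exists K => //; apply: (@eq_representable _ _ (M' t)) => //.
  exact/esym/indepM'.
exact: column_representable.
Qed.

Lemma char_set_neq3 k : char_set M k <-> (prime k /\ k <> 3) \/ k = 0%N.
Proof.
split=> [[F Fk FM]|]; last exact: representable_neq3.
have [pk|->] := has_char_prime Fk; [left | by right].
split=> // k3; have /three_neq0/negP[] : representable F (M' alpha).
  exact: eq_representable (indepM' eisenstein_model) FM.
by rewrite -[3%:R]/(3%:Z%:~R) (has_char_intr_eq0 _ Fk) k3.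
Qed.

Lemma excluded_minor_neq3 L :
  quad_relaxations r n gf4 gf9 d L -> excluded_minor (all_char GF4) M.
Proof.
move=> relaxL; split=> [[_ /(_ 3 (or_introl isT))/char_set_neq3[[]|]]|N NM] //.
split=> [|k kP]; first exact: proper_minor_GF4.
have [k3|/eqP k3] := eqVneq k 3.
  have [//|||K [t [Kk tQ]]] := @quad_model_of_char gf9 k; rewrite ?k3 //.
  exists K; first by rewrite -k3.
  exact: quad_relaxations_minor gf4_model tQ relaxL NM.
have [|K Kk KM] := @representable_neq3 k; first by case: kP; [left | right].
by exists K => //; case: NM => C [D [sC _ _ _ ->]]; apply: representable_minor.
Qed.

End CharacteristicThree.
End ExcludedMinors.

Local Close Scope ring_scope.

Theorem theorem5p3 (GF4 : finFieldType) (card_GF4 : #|GF4| = 4)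
    (alpha : GF4) (alphaE : (alpha ^+ 2 = alpha + 1)%R) :
  [/\ forall k : nat, char_set (V1 alpha) k <-> k = 2,
      forall k : nat, char_set (V2 alpha) k <-> k = 2
    & forall k : nat, char_set (V3 alpha) k <-> k = 2] /\
  [/\ forall k : nat, char_set (P1 alpha) k <-> (prime k /\ k <> 3) \/ k = 0,
      forall k : nat, char_set (P2 alpha) k <-> (prime k /\ k <> 3) \/ k = 0
    & forall k : nat, char_set (P3 alpha) k <-> (prime k /\ k <> 3) \/ k = 0] /\
  [/\ excluded_minor (all_char GF4) (V1 alpha),
      excluded_minor (all_char GF4) (V2 alpha)
    & excluded_minor (all_char GF4) (V3 alpha)] /\
  [/\ excluded_minor (all_char GF4) (P1 alpha),
      excluded_minor (all_char GF4) (P2 alpha)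
    & excluded_minor (all_char GF4) (P3 alpha)] /\
  isomorphic (V2 alpha) (dual (V2 alpha)) /\
  isomorphic (P2 alpha) (dual (P2 alpha)).
Proof.
rewrite (V1_quad alphaE) (V2_quad alphaE) (V3_quad alphaE).
rewrite (P1_quad alphaE) (P2_quad alphaE) (P3_quad alphaE).
have gf4P := gf4_model card_GF4 alphaE.
have eisP := eisenstein_model card_GF4 alphaE.
have v1 F := V1_representable_two_eq0 (F := F) gf4P.
have v2 F := V2_representable_two_eq0 (F := F) gf4P.
have v3 F := V3_representable_two_eq0 (F := F) gf4P.
have p1 F := P1_representable_three_neq0 (F := F) eisP.
have p2 F := P2_representable_three_neq0 (F := F) eisP.
have p3 F := P3_representable_three_neq0 (F := F) eisP.
split; [|split; [|split; [|split; [|split]]]].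
- by split; apply: char_set_eq2.
- by split; [apply: (char_set_neq3 _ _ P1_eisensteinP p1)
            |apply: (char_set_neq3 _ _ P2_eisensteinP p2)
            |apply: (char_set_neq3 _ _ P3_eisensteinP p3)].
- by split; [apply: (excluded_minor_eq2 _ _ v1 V1_relaxationsP)
            |apply: (excluded_minor_eq2 _ _ v2 V2_relaxationsP)
            |apply: (excluded_minor_eq2 _ _ v3 V3_relaxationsP)].
- by split;
    [apply: (excluded_minor_neq3 _ _ P1_eisensteinP p1 P1_relaxationsP)
    |apply: (excluded_minor_neq3 _ _ P2_eisensteinP p2 P2_relaxationsP)
    |apply: (excluded_minor_neq3 _ _ P3_eisensteinP p3 P3_relaxationsP)].
- exact: quad_self_dualP gf4P V2_self_dual.
- exact: quad_self_dualP gf4P P2_self_dual.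
Qed.
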